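(* Let $\mathbf{A}$ be a finite lattice algebra and $\tau$ a finite relational vocabulary (both fixed). For any sentence $\varphi$ of $\mathcal{L}^{\mathbf{A}}(\tau)$, the almost sure value of $\varphi$ (the unique $a\in A$ with $\lim_{n\to\infty}\mu_n(\varphi=a)=1$) can be computed in space polynomial in the length of $\varphi$.
   Context: A lattice algebra is an algebra $\mathbf{A}=\langle A,\wedge,\vee,\dots\rangle$ with a lattice reduct and possibly further finitary operations. Formulas of $\mathcal{L}^{\mathbf{A}}(\tau)$ are built from atomic formulas $R(x_1,\dots,x_{\tau(R)})$, $R\in\tau$, with one connective per operation of $\mathbf{A}$ and quantifiers $\forall,\exists$. An $\mathbf{A}$-valued $\tau$-structure has a nonempty domain $M$ and maps $R^{\mathfrak{M}}\colon M^{\tau(R)}\to A$; truth values $\|\varphi\|^{\mathfrak{M}}\in A$ use the operations of $\mathbf{A}$, infimum for $\forall$, supremum for $\exists$. For probability distributions $p_R\colon A\to[0,1]$ with $p_R(b)>0$ for all $b$, $\Pr_n(\mathfrak{M})=\prod\{p_R(R^{\mathfrak{M}}(\bar i)) : R\in\tau,\ \bar i\in[n]^{\tau(R)}\}$ for structures with domain $[n]$, and $\mu_n(\varphi=a)=\sum\{\Pr_n(\mathfrak{M}):\|\varphi\|^{\mathfrak{M}}=a\}$. For every sentence there is a unique $a$ with $\lim_n\mu_n(\varphi=a)=1$, independent of the choice of the $p_R$; it is called the almost sure value of $\varphi$. *)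

(* Defs.v *)
From HB Require Import structures.
From mathcomp Require Import all_boot all_order all_algebra.
From mathcomp Require Import all_classical all_reals all_analysis.
From Corelib Require BinNums.
Set Implicit Arguments.
Unset Strict Implicit.
Unset Printing Implicit Defensive.
Import Order.TTheory GRing.Theory Num.Theory.
Import numFieldNormedType.Exports.

(* A nonempty finite lattice is automatically bounded, so [finTBLatticeType]
   is no restriction; \bot and \top are not connectives of the logic unless
   they are listed among the additional operations. *)
Record latticeAlgebra (d : Order.disp_t) := LatticeAlgebra {
  carrier :> finTBLatticeType d;
  oper : finType;
  oper_arity : oper -> nat;
  oper_fun : forall o : oper, (oper_arity o).-tuple carrier -> carrier
}.

(* Positive arities: with a nullary R the value of R is distributed as p_R on
   every domain, so the sentence R would have no almost sure value. *)
Record vocabulary := Vocabulary {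
  rel_symbol :> finType;
  rel_arity : rel_symbol -> nat;
  rel_arity_gt0 : forall r, 0 < rel_arity r
}.

Section Logic.
Variables (d : Order.disp_t) (A : latticeAlgebra d) (tau : vocabulary).

Inductive formula :=
| Atom (r : tau) (xs : (rel_arity r).-tuple nat)
| Meet (phi psi : formula)
| Join (phi psi : formula)
| Op (o : oper A) (args : 'I_(oper_arity o) -> formula)
| All (x : nat) (phi : formula)
| Ex (x : nat) (phi : formula).

Fixpoint free_vars (phi : formula) : seq nat :=
  match phi with
  | Atom r xs => xs
  | Meet phi psi | Join phi psi => free_vars phi ++ free_vars psi
  | Op o args => flatten [seq free_vars (args i) | i <- enum 'I_(oper_arity o)]
  | All x phi | Ex x phi => [seq y <- free_vars phi | y != x]
  end.

Definition sentence (phi : formula) : bool := nilp (free_vars phi).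

Definition structure (T : finType) : finType :=
  {dffun forall r : tau, {ffun (rel_arity r).-tuple T -> A}}.

Definition update (T : Type) (v : nat -> T) (x : nat) (e : T) : nat -> T :=
  fun y => if y == x then e else v y.

Fixpoint value (T : finType) (M : structure T) (v : nat -> T)
    (phi : formula) : A :=
  match phi with
  | Atom r xs => M r (map_tuple v xs)
  | Meet phi psi => (value M v phi `&` value M v psi)%O
  | Join phi psi => (value M v phi `|` value M v psi)%O
  | Op o args => oper_fun [tuple value M v (args i) | i < oper_arity o]
  | All x phi => (\meet_(e : T) value M (update v x e) phi)%O
  | Ex x phi => (\join_(e : T) value M (update v x e) phi)%O
  end.

Section Probability.
Variable R : realType.
Local Open Scope ring_scope.
Local Open Scope classical_set_scope.

Definition positive_distributions (p : tau -> A -> R) : Prop :=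
  forall r, (forall b, 0 < p r b) /\ \sum_b p r b = 1.

Definition Pr (p : tau -> A -> R) (n : nat) (M : structure 'I_n) : R :=
  \prod_(r : tau) \prod_(t : (rel_arity r).-tuple 'I_n) p r (M r t).

(* As domains are nonempty, the index is shifted: [mu p phi a n] is
   mu_{n+1}(phi = a).  The assignment is irrelevant when phi is a sentence. *)
Definition mu (p : tau -> A -> R) (phi : formula) (a : A) (n : nat) : R :=
  \sum_(M : structure 'I_n.+1 | value M (fun=> ord0) phi == a) Pr p M.

Definition almost_sure_value (phi : formula) (a : A) : Prop :=
  forall p : tau -> A -> R, positive_distributions p ->
    forall b : A, (mu p phi b n @[n --> \oo] --> (1 : R)) <-> b = a.

End Probability.

(* Formulas as words over a finite alphabet, in prefix notation; a variable is
   written as [LVar] followed by the binary digits of its index, least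
   significant first. *)
Inductive letter :=
| LRel of tau | LOp of oper A
| LMeet | LJoin | LAll | LEx | LVar | LBit of bool.

Definition letter_code (l : letter) : tau + oper A + bool + 'I_5 :=
  match l with
  | LRel r => inl (inl (inl r))
  | LOp o => inl (inl (inr o))
  | LBit b => inl (inr b)
  | LMeet => inr (inord 0)
  | LJoin => inr (inord 1)
  | LAll => inr (inord 2)
  | LEx => inr (inord 3)
  | LVar => inr (inord 4)
  end.

Definition letter_decode (c : tau + oper A + bool + 'I_5) : letter :=
  match c with
  | inl (inl (inl r)) => LRel r
  | inl (inl (inr o)) => LOp o
  | inl (inr b) => LBit b
  | inr i => nth LVar [:: LMeet; LJoin; LAll; LEx; LVar] i
  end.

Lemma letter_codeK : cancel letter_code letter_decode.
Proof. by case=> //=; rewrite inordK. Qed.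

HB.instance Definition _ := Finite.copy letter (can_type letter_codeK).

Fixpoint positive_bits (p : BinNums.positive) : seq bool :=
  match p with
  | BinNums.xH => [:: true]
  | BinNums.xO p => false :: positive_bits p
  | BinNums.xI p => true :: positive_bits p
  end.

Definition bits (x : nat) : seq bool :=
  if bin_of_nat x is BinNums.Npos p then positive_bits p else [::].

Definition encode_var (x : nat) : seq letter :=
  LVar :: [seq LBit b | b <- bits x].

Fixpoint encode (phi : formula) : seq letter :=
  match phi with
  | Atom r xs => LRel r :: flatten [seq encode_var x | x <- xs]
  | Meet phi psi => LMeet :: encode phi ++ encode psi
  | Join phi psi => LJoin :: encode phi ++ encode psi
  | Op o args =>
      LOp o :: flatten [seq encode (args i) | i <- enum 'I_(oper_arity o)]
  | All x phi => LAll :: encode_var x ++ encode phi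
  | Ex x phi => LEx :: encode_var x ++ encode phi
  end.

End Logic.

(* Deterministic multitape Turing machines.  A halting state carries the
   output, which generalizes accepting and rejecting states. *)

Inductive move := MLeft | MStay | MRight.

Record machine (Sigma : finType) (Out : Type) := Machine {
  state : finType;
  work : finType;
  tapes : nat;
  start : state;
  output : state -> option Out;
  delta : state -> {ffun 'I_tapes.+1 -> option (Sigma + work)} ->
          state * {ffun 'I_tapes.+1 -> option (Sigma + work) * move}
}.

Section Machine.
Variables (Sigma : finType) (Out : Type) (M : machine Sigma Out).

(* [None] is the blank. *)
Definition symbol : Type := option (Sigma + work M).

(* The part of a tape in use (input or visited): the cells left of the head,
   nearest first; the cell under the head; the cells right of the head. *)
Record tape := Tape { lefts : seq symbol; scanned : symbol; rights : seq symbol }.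

Definition tape_size (t : tape) : nat := size (lefts t) + 1 + size (rights t).

Definition blank_tape : tape := Tape [::] None [::].

Definition input_tape (w : seq Sigma) : tape :=
  if w is s :: w' then Tape [::] (Some (inl s)) [seq Some (inl s') | s' <- w']
  else blank_tape.

Definition write_move (a : symbol * move) (t : tape) : tape :=
  match a.2 with
  | MStay => Tape (lefts t) a.1 (rights t)
  | MLeft => Tape (behead (lefts t)) (head None (lefts t)) (a.1 :: rights t)
  | MRight => Tape (a.1 :: lefts t) (head None (rights t)) (behead (rights t))
  end.

Definition config : Type := state M * ('I_(tapes M).+1 -> tape).

Definition initial (w : seq Sigma) : config :=
  (start M, fun i => if i == ord0 then input_tape w else blank_tape).

Definition step (c : config) : config :=
  if output c.1 is Some _ then c else
  let: (q, act) := delta c.1 [ffun i => scanned (c.2 i)] in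
  (q, fun i => write_move (act i) (c.2 i)).

Definition space (c : config) : nat := \sum_i tape_size (c.2 i).

Definition computes_in_space (w : seq Sigma) (b : Out) (s : nat) : Prop :=
  (exists n, output (iter n step (initial w)).1 = Some b) /\
  (forall n, space (iter n step (initial w)) <= s).

End Machine.

(* Main.v *)
(* Idea.  A random structure almost surely realizes every one-point extension of
   every n-element configuration (independence of the fresh points, union bound,
   and n^K x^n -> 0).  In such a structure the value of a formula of length n
   depends only on the atomic diagram of the points chosen so far: quantifying
   over a point amounts to quantifying over a choice string, which says whether
   the point equals an older one and, if it does not, lists the values of all
   atoms on the new point and the old ones.  The choice strings have length
   L = n^m for a fixed m and sit in the block [q L, (q+1) L) of one array, q being
   the position of the quantifier in the word, so that positions serve as names of
   points.  A depth-first traversal of the word that steps through all choice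
   strings of each open quantifier like an odometer needs one frame per position
   and n blocks.  The space is bounded through the head positions, which are the
   values of the registers (kept in unary) and the array indices. *)
Require Import Defs.
From mathcomp Require Import all_boot all_order all_algebra.
From mathcomp Require Import all_classical all_reals all_analysis.
From mathcomp Require Import zify ring lra.

Set Implicit Arguments.
Unset Strict Implicit.
Unset Printing Implicit Defensive.

(** * Programs for one-way tapes *)

(** No choice string is rejected, although a string may set several equality bits or repeat a point:
    [chase] gives each one a meaning, and since infima and suprema depend only on the set of values,
    repetitions do no harm. Hence the machine needs no consistency check and simply counts through
    numerals. One digit carries an equality bit together with the values of all relation symbols;
    this is a finite alphabet because [A] and [tau] are fixed. The exponent [m] exceeds every arity,
    so a block has room for the index of every tuple of positions and for one bit per position.
    Running time is not limited, which permits unary registers and a fresh search for each frame and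
    variable. A big-step relation of terminating, legal runs yields halting and the space bound
    together. *)

Section Programs.
Variables (Sigma G : finType) (K B : nat).

Let sym : Type := option (Sigma + G).

(** Each step touches a single tape, chosen by the state. The exit value in [E] is handed to the
    next program, so finite data stay in the control and need no tape. *)
Record prog (E : finType) := Prog {
  pstate : finType;
  pstart : pstate;
  ptape : pstate -> 'I_K.+1;
  pdelta : pstate -> sym -> (pstate + E) * (sym * move)
}.

(* Tapes are one-way infinite here, and [legal] below keeps the heads in [0, B]:
   this is what bounds the space. *)
Record tstate := TState { cell : nat -> nat -> sym; head_of : nat -> nat }.

Definition upd (T : Type) (f : nat -> T) i x := fun j => if j == i then x else f j.

Definition move_head (m : move) (h : nat) :=
  match m with MLeft => h.-1 | MStay => h | MRight => h.+1 end.

Definition act i (a : sym * move) (S : tstate) : tstate :=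
  TState (upd (cell S) i (upd (cell S i) (head_of S i) a.1))
        (upd (head_of S) i (move_head a.2 (head_of S i))).

Definition legal (m : move) (h : nat) :=
  match m with MLeft => 0 < h | MStay => true | MRight => h < B end.

Section Runs.
Variables (E : finType) (P : prog E).

Definition pstep (s : pstate P) (S : tstate) :=
  let i := ptape s in pdelta s (cell S i (head_of S i)).

(** Inductive, so that a derivation is a terminating run with legal moves only: halting and the
    space bound are both read off from it. *)
Inductive runs (s : pstate P) (S : tstate) : E -> tstate -> Prop :=
| RunsExit e a : pstep s S = (inr e, a) -> legal a.2 (head_of S (ptape s)) ->
    runs s S e (act (ptape s) a S)
| RunsStep s' a e S' : pstep s S = (inl s', a) ->
    legal a.2 (head_of S (ptape s)) ->
    runs s' (act (ptape s) a S) e S' -> runs s S e S'.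

Definition wp (S : tstate) (Q : E -> tstate -> Prop) : Prop :=
  exists e S', runs (pstart P) S e S' /\ Q e S'.

Lemma wp_conseq S (Q Q' : E -> tstate -> Prop) :
  wp S Q -> (forall e S', Q e S' -> Q' e S') -> wp S Q'.
Proof. by case=> e [S' [r q]] QQ; exists e, S'; split=> //; apply: QQ. Qed.

End Runs.

Definition pact (E : finType) (i : nat) (f : sym -> E * (sym * move)) : prog E :=
  @Prog E unit tt (fun=> inord i) (fun _ x => (inr (f x).1, (f x).2)).

Lemma wp_act (E : finType) i (f : sym -> E * (sym * move)) S (Q : E -> tstate -> Prop) : i <= K ->
  let r := f (cell S i (head_of S i)) in
  legal r.2.2 (head_of S i) -> Q r.1 (act i r.2 S) ->
  wp (pact i f) S Q.
Proof.
move=> iK /= lg q; have ei : (@inord K i : nat) = i by rewrite inordK.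
exists (f (cell S i (head_of S i))).1,
  (act i (f (cell S i (head_of S i))).2 S); split=> //.
have := @RunsExit E (pact i f) tt S _ _ erefl.
by rewrite /= ei; apply.
Qed.

Definition pret (E : finType) (e : E) : prog E := pact 0 (fun x => (e, (x, MStay))).

Lemma act_stay i S : act i (cell S i (head_of S i), MStay) S = S.
Proof.
case: S => c h; rewrite /act /=; congr TState; apply: funext => j; rewrite /upd.
  by case: eqP => // ->; apply: funext => k; case: eqP => // ->.
by case: eqP => // ->.
Qed.

Lemma wp_ret (E : finType) (e : E) S (Q : E -> tstate -> Prop) : Q e S -> wp (pret e) S Q.
Proof. by move=> q; apply: wp_act; rewrite ?act_stay. Qed.

Section Bind.
Variables (E1 E2 : finType) (P : prog E1) (f : E1 -> prog E2).

Definition bind_state : finType := (pstate P + {e : E1 & pstate (f e)})%type.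

(** The tag of the state keeps the exit value of [P]; finiteness of [E1] keeps the state set
    finite. *)
Definition pbind : prog E2 :=
  @Prog E2 bind_state (inl (pstart P))
    (fun s => match s with inl s => ptape s | inr (existT e t) => ptape t end)
    (fun s x => match s with
     | inl s => let: (r, a) := pdelta s x in
        (inl match r with inl s' => inl s'
             | inr e => inr (existT _ e (pstart (f e))) end, a)
     | inr (existT e t) => let: (r, a) := pdelta t x in
        (match r with inl t' => inl (inr (existT _ e t'))
         | inr e2 => inr e2 end, a)
     end).

Lemma wp_bind S (Q : E2 -> tstate -> Prop) :
  wp P S (fun e S' => wp (f e) S' Q) -> wp pbind S Q.
Proof.
move=> [e [S' [r [e2 [S2 [r2 q]]]]]]; exists e2, S2; split=> // {q}.
have r2' : @runs E2 pbind (inr (existT _ e (pstart (f e)))) S' e2 S2.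
  elim: r2 => {S2 e2} [s S0 e2 a h l|s S0 s' a e2 S2 h l _ IH].
    by apply: (@RunsExit E2 pbind (inr (existT _ e s))) => //;
      move: h; rewrite /pstep /= => ->.
  apply: (@RunsStep E2 pbind (inr (existT _ e s)) _ (inr (existT _ e s')) a) => //.
  by move: h; rewrite /pstep /= => ->.
have: pstart pbind = inl (pstart P) by [].
move: (pstart P) (pstart pbind) r => s0 _ r ->.
elim: r r2' => {r2 S' e} [s S0 e a h l|s S0 s' a e S' h l _ IH] r2'.
  apply: (@RunsStep E2 pbind (inl s) _ _ a) r2' => //.
  by move: h; rewrite /pstep /= => ->.
apply: (@RunsStep E2 pbind (inl s) _ (inl s') a) => //; last exact: IH.
by move: h; rewrite /pstep /= => ->.
Qed.

End Bind.

Section Loop.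
Variables (I E : finType) (body : I -> prog (I + E)%type).

Definition loop_state : finType := {i : I & pstate (body i)}.

Definition ploop (i0 : I) : prog E :=
  @Prog E loop_state (existT _ i0 (pstart (body i0)))
    (fun s => let: existT i t := s in ptape t)
    (fun s x => let: existT i t := s in
      let: (r, a) := pdelta t x in
      (match r with inl t' => inl (existT _ i t')
       | inr (inl j) => inl (existT _ j (pstart (body j)))
       | inr (inr e) => inr e end, a)).

(** [ploop i] and [ploop j] share states and transitions and differ in the start state only. *)
Lemma runs_loop_start i j s S e S' :
  @runs E (ploop j) s S e S' -> @runs E (ploop i) s S e S'.
Proof.
elim=> {s S e S'} [s S e a h l|s S s' a e S' h l _ IH].
  exact: (@RunsExit E (ploop i)).
exact: (@RunsStep E (ploop i) _ _ s' a).
Qed.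

(** A single unfolding; termination is left to the induction made at each use. *)
Lemma wp_loop i S (Q : E -> tstate -> Prop) :
  wp (body i) S (fun r S' => match r with
    | inl j => wp (ploop j) S' Q | inr e => Q e S' end) ->
  wp (ploop i) S Q.
Proof.
have run0 : forall s S r S', runs s S r S' -> forall Q',
    match r with inl j => wp (ploop j) S' Q' | inr e => Q' e S' end ->
    exists e S2, @runs E (ploop i) (existT _ i s) S e S2 /\ Q' e S2.
  move=> s0 S0 r S'; elim=> {s0 S0 r S'} [s S0 [j|e] a h l|s S0 s' a r S' h l _ IH] Q'.
  - move=> [e [S2 [r q]]]; exists e, S2; split=> //.
    apply: (@RunsStep E (ploop i) (existT _ i s) _
             (existT _ j (pstart (body j))) a) => //;
      last exact: runs_loop_start r.
    by move: h; rewrite /pstep /= => ->.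
  - move=> q; exists e, (act (ptape s) a S0); split=> //.
    apply: (@RunsExit E (ploop i) (existT _ i s)) => //.
    by move: h; rewrite /pstep /= => ->.
  - move=> /IH [e [S2 [r2 q]]]; exists e, S2; split=> //.
    apply: (@RunsStep E (ploop i) (existT _ i s) _ (existT _ i s') a) => //.
    by move: h; rewrite /pstep /= => ->.
by move=> [r [S' [r1 q]]]; apply: (run0 _ _ _ _ r1).
Qed.

End Loop.

(** * Compilation to multitape Turing machines *)

Section Compile.
Variables (E : finType) (P : prog E).

Definition compile : machine Sigma E :=
  @Machine Sigma E (pstate P + E)%type G K (inl (pstart P))
    (fun s => match s with inl _ => None | inr e => Some e end)
    (fun s x => match s with
     | inl s => let: (r, a) := pdelta s (x (ptape s)) in
         (r, [ffun i => if i == ptape s then a else (x i, MStay)])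
     | inr _ => (s, [ffun i => (x i, MStay)])
     end).

(** The used part of a tape never shrinks, so its size belongs to the invariant. The default [None]
    of [nth] stands for the cells beyond it. *)
Definition represents (S : tstate) (T : 'I_K.+1 -> tape compile) : Prop :=
  forall i, [/\ size (lefts (T i)) = head_of S i,
    forall k, nth None (rev (lefts (T i)) ++ scanned (T i) :: rights (T i)) k
              = cell S i k & tape_size (T i) <= B.+1].

Lemma represents_scanned S T i :
  represents S T -> scanned (T i) = cell S i (head_of S i).
Proof.
move=> /(_ i) [hs hc _]; rewrite -hc -hs nth_cat size_rev ltnn subnn //.
Qed.

(** A legal left move finds [lefts] nonempty; a right move enlarges the tape only from its last used
    cell, where [h < B] leaves room. *)
Lemma represents_act S T (i : 'I_K.+1) a : represents S T ->
  legal a.2 (head_of S i) ->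
  represents (act i a S) (fun j => @write_move Sigma E compile (if j == i then a
     else (scanned (T j), MStay)) (T j)).
Proof.
move=> rep lg j; have [hs hc hb] := rep j.
rewrite /act /= /upd -val_eqE /=; case: (eqVneq (val j) (val i)) => [/val_inj e|_]; last first.
  by move: hs hc hb; case: (T j) => l s r /=.
move: lg; rewrite -e => lg {e i}; move: hs hc hb.
rewrite /write_move /tape_size; case: (T j) => l s r /= hs hc hb.
have hk k : nth None (rev l ++ a.1 :: r) k =
    (if k == head_of S j then a.1 else cell S j k).
  rewrite -hc -hs !nth_cat size_rev; case: (ltngtP k (size l)) => // h.
    by move: h; case: (k - size l) (subn_gt0 (size l) k) => [|m] // <-.
  by rewrite h subnn.
move: lg; rewrite /legal; case: a.2 => /= lg.
- move: hs hk hb lg; case: l hc => [|x l] hc /= hs hk hb lg; first by rewrite -hs in lg.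
  split; [by rewrite -hs| |lia].
  by move=> k; rewrite -hk rev_cons cat_rcons.
- by split.
- split; [by rewrite hs| |by case: r {hc hk} hb => /= *; lia].
  move=> k; rewrite -hk rev_cons cat_rcons.
  case: r {hc hk hb} => //=; rewrite !nth_cat size_rev /=.
  by case: ltnP => // _; case: (k - _) => [|[|m]] //=; rewrite nth_nil.
Qed.

Lemma space_represents S T (s : pstate P + E) :
  represents S T -> @Defs.space Sigma E compile (s, T) <= K.+1 * B.+1.
Proof.
move=> rep; have -> : K.+1 * B.+1 = \sum_(i < K.+1) B.+1.
  by rewrite sum_nat_const card_ord.
by apply: leq_sum => i _; have [] := rep i.
Qed.

Lemma compile_runs s S e S' T : runs s S e S' -> represents S T ->
  (exists n, output (iter n (@step _ _ compile) (inl s, T)).1 = Some e) /\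
  forall n, Defs.space (iter n (@step _ _ compile) (inl s, T)) <= K.+1 * B.+1.
Proof.
pose wm i a (T : 'I_K.+1 -> tape compile) :=
  fun j => @write_move Sigma E compile (if j == i then a else (scanned (T j), MStay)) (T j).
have stepE s0 (T0 : 'I_K.+1 -> tape compile) r a : @pdelta E P s0 (scanned (T0 (ptape s0))) = (r, a) ->
    @step _ _ compile (inl s0, T0) = (r, wm (ptape s0) a T0).
  move=> h; rewrite /step /= ffunE h; congr pair; apply: funext => j.
  by rewrite !ffunE /wm; case: ifP => // /eqP.
have halt n e0 T0 : iter n (@step _ _ compile) (inr e0, T0) = (inr e0, T0).
  by elim: n => //= n ->.
move=> r; elim: r T => {s S e S'} [s S e a h l|s S s' a e S' h l _ IH] T rep;
  move: h; rewrite /pstep -(represents_scanned _ rep) => /stepE h;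
  have rep' := represents_act rep l; rewrite -/(wm _ _ _) in rep'.
- split; first by exists 1; rewrite /= h.
  case=> [|n]; first exact: space_represents rep.
  by rewrite iterSr h halt; apply: space_represents rep'.
- have [[n hn] hs] := IH _ rep'; split; first by exists n.+1; rewrite iterSr h.
  case=> [|k]; first exact: space_represents rep.
  by rewrite iterSr h.
Qed.

Lemma compile_computes w S e S' : size w <= B ->
  cell S 0 = nth None [seq Some (inl l) | l <- w] ->
  (forall i, 0 < i <= K -> cell S i = fun=> None) ->
  (forall i, head_of S i = 0) -> runs (pstart P) S e S' ->
  computes_in_space compile w e (K.+1 * B.+1).
Proof.
move=> wB c0 cS hS r; apply: compile_runs r _ => i /=; rewrite hS.
case: (eqVneq i ord0) => [->|ni]; last first.
  rewrite cS; first by split=> // -[|k] //=; rewrite nth_nil.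
  by rewrite lt0n -ltnS ltn_ord andbT; apply: contra ni.
rewrite /= c0.
case: w wB {c0} => [|l w] /= wB; split=> //; first by case=> //= k; rewrite !nth_nil.
by rewrite /tape_size /= size_map; lia.
Qed.

End Compile.

End Programs.

(** * Unary registers and arrays *)

Notation "x <~ P ;; Q" := (pbind P (fun x => Q))
  (at level 61, P at next level, right associativity).
Notation "P ;; Q" := (pbind P (fun=> Q)) (at level 61, right associativity).

Inductive expr :=
| Cst of nat | Reg of nat
| Plus of expr & expr | Times of expr & expr | Minus of expr & expr.

Fixpoint eval (h : nat -> nat) e :=
  match e with
  | Cst n => n
  | Reg i => h i
  | Plus a b => eval h a + eval h b
  | Times a b => eval h a * eval h b
  | Minus a b => eval h a - eval h b
  end.

(* Bounds every register during the evaluation of the expression. *)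
Fixpoint eval_bound (h : nat -> nat) e :=
  match e with
  | Cst n => n
  | Reg i => h i
  | Plus a b | Minus a b => eval_bound h a + eval_bound h b
  | Times a b => eval_bound h a * (eval_bound h b).+1
  end.

(** Counts the scratch registers used by [padd]: one to copy a register back, one for the counter of
    a product, two for the operands of a difference. *)
Fixpoint depth e :=
  match e with
  | Cst _ => 0
  | Reg _ => 1
  | Plus a b => maxn (depth a) (depth b)
  | Times a b => (maxn (depth a) (depth b)).+1
  | Minus a b => (maxn (depth a) (depth b)).+2
  end.

Fixpoint regs_in z e :=
  match e with
  | Cst _ => true
  | Reg i => 2 < i < z
  | Plus a b | Times a b | Minus a b => regs_in z a && regs_in z b
  end.

Lemma eval_le h e : eval h e <= eval_bound h e.
Proof. by elim: e => //= *; nia. Qed.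

Lemma eq_eval z h h' e : regs_in z e -> (forall i, 2 < i < z -> h i = h' i) ->
  (eval h e = eval h' e) * (eval_bound h e = eval_bound h' e).
Proof.
move=> + hh; elim: e => //= [i /hh -> //|a IHa b IHb|a IHa b IHb|a IHa b IHb];
  by case/andP=> /IHa [-> ->] /IHb [-> ->].
Qed.

Section Registers.
Variables (Sigma G : finType) (mark : G) (K B : nat).
Let sym : Type := option (Sigma + G).
Notation prog := (prog Sigma G K).
Notation tstate := (tstate Sigma G).
Implicit Types (h : nat -> nat) (c : nat -> nat -> sym).

(* A register is a tape whose cell 0 is marked; its value is the position of
   the head. *)
Definition register_cells (k : nat) : sym := if k == 0 then Some (inr mark) else None.

Definition with_registers c := forall i, 2 < i -> c i = register_cells.

Definition pright i : prog unit := pact K i (fun x => (tt, (x, MRight))).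
Definition pleft i : prog unit := pact K i (fun x => (tt, (x, MLeft))).
Definition pscan i : prog (option (Sigma + G))%type := pact K i (fun x => (x, (x, MStay))).
Definition pwrite i (y : sym) : prog unit := pact K i (fun=> (tt, (y, MStay))).
Definition pzero i : prog bool := pact K i (fun x => (x == Some (inr mark), (x, MStay))).

Lemma upd_id (T : Type) (f : nat -> T) i : upd f i (f i) = f.
Proof. by apply: funext => j; rewrite /upd; case: eqP => // ->. Qed.

Lemma act_move i (m : move) c h :
  act i (c i (h i), m) (TState c h) = TState c (upd h i (move_head m (h i))).
Proof. by rewrite /act /= !upd_id. Qed.

Lemma wp_right i c h (Q : unit -> tstate -> Prop) : i <= K -> h i < B ->
  Q tt (TState c (upd h i (h i).+1)) -> wp B (pright i) (TState c h) Q.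
Proof. by move=> iK hB q; apply: wp_act => //; rewrite act_move. Qed.

Lemma wp_left i c h (Q : unit -> tstate -> Prop) : i <= K -> 0 < h i ->
  Q tt (TState c (upd h i (h i).-1)) -> wp B (pleft i) (TState c h) Q.
Proof. by move=> iK hB q; apply: wp_act => //; rewrite act_move. Qed.

Lemma wp_scan i c h (Q : option (Sigma + G)%type -> tstate -> Prop) : i <= K ->
  Q (c i (h i)) (TState c h) -> wp B (pscan i) (TState c h) Q.
Proof. by move=> iK q; apply: wp_act => //; rewrite act_move /= upd_id. Qed.

Lemma wp_write i y c h (Q : unit -> tstate -> Prop) : i <= K ->
  Q tt (TState (upd c i (upd (c i) (h i) y)) h) -> wp B (pwrite i y) (TState c h) Q.
Proof. by move=> iK q; apply: wp_act => //=; rewrite /act /= upd_id. Qed.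

Lemma wp_zero i c h (Q : bool -> tstate -> Prop) : i <= K -> c i = register_cells ->
  Q (h i == 0) (TState c h) -> wp B (pzero i) (TState c h) Q.
Proof.
move=> iK ci q; apply: wp_act => //; rewrite act_move /= upd_id ci /register_cells.
by case: ifP q => // _; rewrite eqxx.
Qed.

Definition pdrain i (P : prog unit) : prog unit :=
  ploop (fun _ : unit => z <~ pzero i ;;
    if z then pret Sigma G K (inr tt : unit + unit)%type
    else pleft i ;; P ;; pret Sigma G K (inl tt : unit + unit)%type) tt.

(** The family [f] is the loop invariant: [f k] gives all heads when [k] rounds remain. *)
Lemma wp_drain i (P : prog unit) c (f : nat -> nat -> nat) n h (Q : unit -> tstate -> Prop) :
  i <= K -> c i = register_cells ->
  h = f n -> (forall k, k <= n -> f k i = k) ->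
  (forall k, k < n -> forall Q' : unit -> tstate -> Prop, Q' tt (TState c (f k)) ->
    wp B P (TState c (upd (f k.+1) i k)) Q') ->
  Q tt (TState c (f 0)) -> wp B (pdrain i P) (TState c h) Q.
Proof.
move=> iK ci -> {h}; elim: n => [|n IH] fi fP q.
  by apply: wp_loop; apply: wp_bind; apply: wp_zero => //; rewrite fi //; apply: wp_ret.
apply: wp_loop; apply: wp_bind; apply: wp_zero => //; rewrite fi //=.
apply: wp_bind; apply: wp_left; rewrite ?fi //; apply: wp_bind; apply: (fP) => //.
apply: wp_ret; apply: IH => // k kn; first by apply: (fi); lia.
by apply: fP; lia.
Qed.

Definition pdec i : prog unit :=
  z <~ pzero i ;; if z then pret Sigma G K tt else pleft i.

Fixpoint padd_cst n d : prog unit :=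
  if n is n'.+1 then pright d ;; padd_cst n' d else pret Sigma G K tt.

(* Adds [e] to register [d]; the registers from [s] on are scratch. *)
Fixpoint padd e d s : prog unit :=
  match e with
  | Cst n => padd_cst n d
  | Reg i => pdrain i (pright d ;; pright s) ;; pdrain s (pright i)
  | Plus a b => padd a d s ;; padd b d s
  | Times a b => padd a s s.+1 ;; pdrain s (padd b d s.+1)
  | Minus a b => padd a s s.+1 ;; padd b s.+1 s.+2 ;;
      pdrain s.+1 (pdec s) ;; pdrain s (pright d)
  end.

Ltac upd_cases := rewrite /upd;
  repeat match goal with
    |- context [if ?a == ?b then _ else _] => case: (eqVneq a b) => ? end;
  subst; try lia.
Ltac upd_eq := apply: funext => ?; upd_cases.

Lemma wp_add_cst n d c h (Q : unit -> tstate -> Prop) : d <= K -> h d + n <= B ->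
  Q tt (TState c (upd h d (h d + n))) -> wp B (padd_cst n d) (TState c h) Q.
Proof.
move=> dK; elim: n h => [|n IH] h hB q /=.
  by apply: wp_ret; rewrite addn0 upd_id in q.
apply: wp_bind; apply: wp_right => //; first lia.
have e : upd (upd h d (h d).+1) d (upd h d (h d).+1 d + n) = upd h d (h d + n.+1).
  by apply: funext => j; rewrite /upd eqxx; case: eqP => //; lia.
apply: IH; rewrite ?e // /upd eqxx; lia.
Qed.

(** Reading a register empties it, so its value travels through scratch register [s] and back.
    Scratch registers are 0 before and, as only [d] changes, also after. *)
Lemma wp_add z e c h d s (Q : unit -> tstate -> Prop) :
  with_registers c -> 2 < z <= d -> d < s -> s + depth e <= K.+1 -> regs_in z e ->
  (forall i, s <= i -> h i = 0) -> h d + eval_bound h e <= B ->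
  Q tt (TState c (upd h d (h d + eval h e))) ->
  wp B (padd e d s) (TState c h) Q.
Proof.
move=> cr; elim: e h d s Q =>
  [n|i|a IHa b IHb|a IHa b IHb|a IHa b IHb] h d s Q zd ds sK /= re hs hB q.
- by apply: wp_add_cst => //=; move: sK => /=; lia.
- move: sK => /= sK; have hs0 := hs s (leqnn s).
  apply: wp_bind.
  apply: (@wp_drain _ _ _
    (fun k => upd (upd (upd h s (h i - k)) d (h d + (h i - k))) i k) (h i)).
  + by lia.
  + by apply: cr; lia.
  + by upd_eq.
  + by move=> k _; rewrite /upd eqxx.
  + move=> k ki Q' q'; apply: wp_bind; apply: wp_right; first lia.
      by upd_cases.
    apply: wp_right; first lia.
      by upd_cases.
    congr (Q' tt (TState c _)): q'; upd_eq.
  apply: (@wp_drain _ _ _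
    (fun k => upd (upd (upd h s k) d (h d + h i)) i (h i - k)) (h i)).
  + by lia.
  + by apply: cr; lia.
  + by upd_eq.
  + by move=> k _; upd_cases.
  + move=> k ki Q' q'; apply: wp_right; first lia.
      by upd_cases.
    congr (Q' tt (TState c _)): q'; upd_eq.
  by congr (Q tt (TState c _)): q; upd_eq.
- case/andP: re => ra rb; move: sK => /= sK.
  have E := @eq_eval z h (upd h d (h d + eval h a)) b rb.
  have le := eval_le h a.
  have [] := E; first by move=> i iz; rewrite /upd; case: eqVneq => // ?; lia.
  move=> E1 E2.
  apply: wp_bind; apply: IHa => //; try lia.
  apply: IHb => //; try lia.
  + by move=> i si; rewrite /upd; case: eqVneq => [?|_]; [lia|exact: hs].
  + by rewrite -E2 /upd eqxx; lia.
  + by congr (Q tt (TState c _)): q; rewrite -E1; upd_eq.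
- case/andP: re => ra rb; move: sK => /= sK; have hs0 := hs s (leqnn s).
  have le := eval_le h a; have le' := eval_le h b.
  apply: wp_bind; apply: IHa => //; try lia.
    by move=> i si; apply: hs; lia.
  apply: (@wp_drain _ _ _
    (fun k => upd (upd h s k) d (h d + (eval h a - k) * eval h b)) (eval h a)).
  + by lia.
  + by apply: cr; lia.
  + by upd_eq.
  + by move=> k _; upd_cases.
  + move=> k ki Q' q'.
    (* [b] is evaluated anew in every round; the registers changed so far lie outside the range
       allowed by [regs_in z], so its value is still the one under [h]. *)
    have [||E1 E2] := @eq_eval z h (upd (upd (upd h s k.+1) d
      (h d + (eval h a - k.+1) * eval h b)) s k) b => //.
      by move=> i iz; upd_cases.
    apply: IHb => //; try lia.
    * by move=> i si; upd_cases; apply: hs; lia.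
    * rewrite -E2; upd_cases; nia.
    * congr (Q' tt (TState c _)): q'; rewrite -E1; upd_eq.
      by have -> : eval h a - k = (eval h a - k.+1).+1 by [lia]; rewrite mulSn; lia.
  by congr (Q tt (TState c _)): q; rewrite subn0; upd_eq.
case/andP: re => ra rb; move: sK => /= sK; have hs0 := hs s (leqnn s).
have hs1 := hs s.+1 (leqnSn s).
have le := eval_le h a; have le' := eval_le h b.
apply: wp_bind; apply: IHa => //; try lia.
  by move=> i si; apply: hs; lia.
have [||E1 E2] := @eq_eval z h (upd h s (h s + eval h a)) b => //.
  by move=> i iz; rewrite /upd; case: eqVneq => // ?; lia.
apply: wp_bind; apply: IHb => //; try lia.
  by move=> i si; rewrite /upd; case: eqVneq => [?|_]; [lia|apply: hs; lia].
  by rewrite -E2 /upd; case: eqVneq => ?; lia.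
(* Decrements stop at 0, which makes the difference truncated even while [k] of them remain. *)
apply: wp_bind; rewrite -E1; apply: (@wp_drain _ _ _
    (fun k => upd (upd h s (eval h a - (eval h b - k))) s.+1 k) (eval h b)).
- by lia.
- by apply: cr; lia.
- by upd_eq.
- by move=> k _; rewrite /upd eqxx.
- move=> k ki Q' q'; apply: wp_bind; apply: wp_zero; first lia.
    by apply: cr; lia.
  rewrite [X in X == 0](_ : _ = eval h a - (eval h b - k.+1)); last by upd_cases.
  case: eqVneq => [z0|nz].
    by apply: wp_ret; congr (Q' tt (TState c _)): q'; upd_eq.
  apply: wp_left; first lia.
    by upd_cases.
  by congr (Q' tt (TState c _)): q'; upd_eq.
apply: (@wp_drain _ _ _
    (fun k => upd (upd h s k) d (h d + (eval h a - eval h b - k))) (eval h a - eval h b)).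
- by lia.
- by apply: cr; lia.
- by upd_eq.
- by move=> k _; upd_cases.
- move=> k ki Q' q'; apply: wp_right; first lia.
    by upd_cases.
  by congr (Q' tt (TState c _)): q'; upd_eq.
by congr (Q tt (TState c _)): q; upd_eq.
Qed.

(* Runs [P] with the head of array [a] at the position given by register [s]. *)
Definition pat (E : finType) a s (P : prog E) : prog E :=
  pdrain s (pright s.+1 ;; pright a) ;;
  x <~ P ;; pdrain s.+1 (pright s ;; pleft a) ;; pret Sigma G K x.

(** The count passes from [s] to [s.+1] while the head goes out, and back on its return, so array
    heads rest at 0 between operations. *)
Lemma wp_at (E : finType) a s (P : prog E) c c' h n x (Q : E -> tstate -> Prop) :
  with_registers c -> with_registers c' -> a < 3 -> 2 < s < K ->
  h a = 0 -> h s = n -> h s.+1 = 0 -> n <= B ->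
  (forall Q' : E -> tstate -> Prop,
     Q' x (TState c' (upd (upd (upd h a n) s 0) s.+1 n)) ->
     wp B P (TState c (upd (upd (upd h a n) s 0) s.+1 n)) Q') ->
  Q x (TState c' h) -> wp B (pat a s P) (TState c h) Q.
Proof.
move=> cr cr' a3 sK ha hs hs1 nB hP q; apply: wp_bind.
apply: (@wp_drain _ _ _
  (fun k => upd (upd (upd h a (n - k)) s k) s.+1 (n - k)) n).
- by lia.
- by apply: cr; lia.
- by upd_eq.
- by move=> k _; upd_cases.
- move=> k ki Q' q'; apply: wp_bind; apply: wp_right; first lia.
    by upd_cases.
  apply: wp_right; first lia.
    by upd_cases.
  by congr (Q' tt (TState c _)): q'; upd_eq.
rewrite subn0; apply: wp_bind; apply: hP; apply: wp_bind.
apply: (@wp_drain _ _ _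
  (fun k => upd (upd (upd h a k) s (n - k)) s.+1 k) n).
- by lia.
- by apply: cr'; lia.
- by upd_eq.
- by move=> k _; upd_cases.
- move=> k ki Q' q'; apply: wp_bind; apply: wp_right; first lia.
    by upd_cases.
  apply: wp_left; first lia.
    by upd_cases.
  by congr (Q' tt (TState c' _)): q'; upd_eq.
by apply: wp_ret; congr (Q x (TState c' _)): q; upd_eq.
Qed.

Definition with_arrays (W F D : nat -> sym) i :=
  match i with 0 => W | 1 => F | 2 => D | _ => register_cells end.

(* Three arrays, and registers whose values are listed from index 3 on. *)
Definition ram W F D (l : seq nat) : tstate := TState (with_arrays W F D) (nth 0 l).

Section Ram.
Variable z : nat.
Hypothesis zK : 2 < z < K.

Definition pclear i := pdrain i (pret Sigma G K tt).

Definition ptest e : prog bool :=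
  padd e z z.+1 ;; b <~ pzero z ;; pclear z ;; pret Sigma G K b.

(** The value is formed in register [z] before register [i] is cleared, so that [e] may mention
    [i]. *)
Definition passign i e : prog unit :=
  padd e z z.+1 ;; pclear i ;; pdrain z (pright i).

Definition pread a e : prog (option (Sigma + G))%type :=
  padd e z z.+1 ;; x <~ pat a z (pscan a) ;; pclear z ;; pret Sigma G K x.

Definition pstore a e y : prog unit :=
  padd e z z.+1 ;; pat a z (pwrite a y) ;; pclear z.

Lemma wp_clear c i h (Q : unit -> tstate -> Prop) : with_registers c -> 2 < i <= K ->
  Q tt (TState c (upd h i 0)) -> wp B (pclear i) (TState c h) Q.
Proof.
move=> cr iK q; apply: (@wp_drain _ _ _ (fun k => upd h i k) (h i)) => //.
- by lia.
- by apply: cr; lia.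
- by rewrite upd_id.
- by move=> k _; rewrite /upd eqxx.
- by move=> k _ Q' q'; apply: wp_ret; congr (Q' tt (TState c _)): q'; upd_eq.
Qed.

Variables (W : nat -> sym).
Implicit Types (F D : nat -> sym) (l : seq nat).

Lemma ram_registers F D : with_registers (with_arrays W F D).
Proof. by case=> [|[|[|i]]]. Qed.

(** Registers from [z] on lie beyond the list [l], hence are 0 by the default of [nth]: the form
    [ram] itself says that the scratch space is clean. *)
Lemma wp_ram_add F D l e (Q : unit -> tstate -> Prop) :
  size l = z -> z + depth e <= K -> regs_in z e -> eval_bound (nth 0 l) e <= B ->
  Q tt (TState (with_arrays W F D) (upd (nth 0 l) z (eval (nth 0 l) e))) ->
  wp B (padd e z z.+1) (ram W F D l) Q.
Proof.
move=> sl dK re eB q; have l0 i : z <= i -> nth 0 l i = 0.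
  by move=> zi; rewrite nth_default // sl.
apply: (@wp_add z) => //; try lia; first exact: ram_registers.
- by move=> i zi; apply: l0; lia.
- by rewrite l0.
- by rewrite (l0 z).
Qed.

Lemma wp_test F D l e (Q : bool -> tstate -> Prop) :
  size l = z -> z + depth e <= K -> regs_in z e -> eval_bound (nth 0 l) e <= B ->
  Q (eval (nth 0 l) e == 0) (ram W F D l) -> wp B (ptest e) (ram W F D l) Q.
Proof.
move=> sl dK re eB q; apply: wp_bind; apply: wp_ram_add => //.
apply: wp_bind; apply: wp_zero; [lia|by apply: ram_registers; lia|].
apply: wp_bind; apply: wp_clear; [exact: ram_registers|lia|].
apply: wp_ret; rewrite {1}/upd eqxx; congr (Q _ (TState _ _)): q.
by apply: funext => i; rewrite /upd; case: eqVneq => // ->; rewrite nth_default ?sl.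
Qed.

Lemma wp_assign F D l i e (Q : unit -> tstate -> Prop) :
  size l = z -> 2 < i < z ->
  z + depth e <= K -> regs_in z e -> eval_bound (nth 0 l) e <= B ->
  Q tt (ram W F D (set_nth 0 l i (eval (nth 0 l) e))) ->
  wp B (passign i e) (ram W F D l) Q.
Proof.
move=> sl iz dK re eB q; have le := eval_le (nth 0 l) e.
apply: wp_bind; apply: wp_ram_add => //.
apply: wp_bind; apply: wp_clear; [exact: ram_registers|lia|].
move: (eval _ e) => v in le q *.
have lz : nth 0 l z = 0 by rewrite nth_default ?sl.
apply: (@wp_drain _ _ _ (fun k => upd (upd (nth 0 l) i (v - k)) z k) v).
- by lia.
- by apply: ram_registers; lia.
- by upd_eq.
- by move=> k _; rewrite /upd eqxx.
- move=> k kv Q' q'; apply: wp_right; first lia.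
    by upd_cases.
  by congr (Q' tt (TState _ _)): q'; upd_eq.
congr (Q tt (TState _ _)): q; apply: funext => j; rewrite nth_set_nth /=.
by upd_cases.
Qed.

Lemma wp_read F D l a e (Q : option (Sigma + G)%type -> tstate -> Prop) :
  size l = z -> a < 3 -> nth 0 l a = 0 ->
  z + depth e <= K -> regs_in z e -> eval_bound (nth 0 l) e <= B ->
  Q (with_arrays W F D a (eval (nth 0 l) e)) (ram W F D l) ->
  wp B (pread a e) (ram W F D l) Q.
Proof.
move=> sl a3 la dK re eB q; have le := eval_le (nth 0 l) e.
apply: wp_bind; apply: wp_ram_add => //; have cr := ram_registers F D.
move: (eval _ e) => v in le q *.
have l0 i : z <= i -> nth 0 l i = 0 by move=> zi; rewrite nth_default // sl.
apply: wp_bind.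
apply: (@wp_at _ _ _ _ _ _ _ v (with_arrays W F D a v) _ cr cr a3) => //.
- by rewrite /upd; case: eqVneq => // ?; lia.
- by rewrite /upd eqxx.
- by rewrite /upd; case: eqVneq => [?|_]; rewrite ?l0; lia.
- by lia.
- move=> Q' q'; apply: wp_scan; first lia.
  by upd_cases; exact: q'.
apply: wp_bind; apply: wp_clear => //; first lia.
apply: wp_ret; congr (Q _ (TState _ _)): q.
by apply: funext => i; rewrite /upd; case: eqVneq => // ->; rewrite l0.
Qed.

Lemma wp_store F D l a e y (Q : unit -> tstate -> Prop) :
  size l = z -> 0 < a < 3 -> nth 0 l a = 0 ->
  z + depth e <= K -> regs_in z e -> eval_bound (nth 0 l) e <= B ->
  Q tt (if a == 1 then ram W (upd F (eval (nth 0 l) e) y) D l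
        else ram W F (upd D (eval (nth 0 l) e) y) l) ->
  wp B (pstore a e y) (ram W F D l) Q.
Proof.
move=> sl a3 la dK re eB q; have le := eval_le (nth 0 l) e.
apply: wp_bind; apply: wp_ram_add => //; have cr := ram_registers F D.
move: (eval _ e) => v in le q *.
have l0 i : z <= i -> nth 0 l i = 0 by move=> zi; rewrite nth_default // sl.
pose c' := with_arrays W (if a == 1 then upd F v y else F) (if a == 1 then D else upd D v y).
have cr' : with_registers c' by exact: ram_registers.
apply: wp_bind; apply: (@wp_at _ _ _ _ _ c' _ v tt _ cr cr') => //; try lia.
- by rewrite /upd; case: eqVneq => // ?; lia.
- by rewrite /upd eqxx.
- by rewrite /upd; case: eqVneq => [?|_]; rewrite ?l0; lia.
- move=> Q' q'; apply: wp_write; first lia.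
  congr (Q' tt (TState _ _)): q'; rewrite /c'.
  apply: funext => i.
  rewrite (_ : upd (upd (upd (upd (nth 0 l) z v) a v) z 0) z.+1 v a = v); last by upd_cases.
  rewrite [RHS]/(upd _ _ _ _).
  case: (eqVneq i a) => [->|]; first by case: a a3 {la q c' cr'} => [|[|[|]]].
  by case: a a3 {la q c' cr'} => [|[|[|]]] //; case: i => [|[|[|]]].
apply: wp_clear => //; first lia.
have -> : upd (upd (nth 0 l) z v) z 0 = nth 0 l.
  by apply: funext => i; rewrite /upd; case: eqVneq => // ->; rewrite l0.
by move: q; rewrite /c'; case: ifP.
Qed.

End Ram.
End Registers.

(** * Almost sure values by exhaustive search *)

Section BigLattice.
Variables (disp : Order.disp_t) (A : finTBLatticeType disp) (I J : finType).
Variables (F : I -> A) (H : J -> A).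
Hypothesis FH : forall i, exists j, F i = H j.
Hypothesis HF : forall j, exists i, F i = H j.

(** Multiplicity is irrelevant to an infimum; this is what allows an index set of strings in place
    of one of points. *)
Lemma eq_meet_image : (\meet_i F i = \meet_j H j)%O.
Proof.
apply/eqP; rewrite Order.POrderTheory.eq_le; apply/andP; split;
  apply/Order.TMeetTheory.meetsP => k _.
- by have [i <-] := HF k; apply: Order.TMeetTheory.meets_inf.
- by have [j ->] := FH k; apply: Order.TMeetTheory.meets_inf.
Qed.

Lemma eq_join_image : (\join_i F i = \join_j H j)%O.
Proof.
apply/eqP; rewrite Order.POrderTheory.eq_le; apply/andP; split;
  apply/Order.BJoinTheory.joinsP => k _.
- by have [j ->] := FH k; apply: Order.BJoinTheory.joins_sup.
- by have [i <-] := HF k; apply: Order.BJoinTheory.joins_sup.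
Qed.

End BigLattice.

(** * Symbolic evaluation over choice strings *)

Section Evaluation.
Variables (disp : Order.disp_t) (A : latticeAlgebra disp) (tau : vocabulary).
Variables (S : finType) (digit : S -> bool * {ffun tau -> A}).
Variables (n L : nat).
Implicit Types (D : nat -> S) (t ps : seq nat) (env : seq (nat * nat)).

(* [D] consists of blocks of length [L], the block at [p] being the choice string
   of the quantifier at position [p] of the word: its digit [s] says whether the
   point chosen at [p] is the one chosen at [s], and its digit [flat_index t]
   gives the values of the atoms on the tuples [t] of maximum [p]. *)
Definition same_bit D p s := (digit (D (p * L + s))).1.

(** Resolves an arbitrary string, with [ps] listing the older quantifiers from the inside out: a set
    bit at [s] identifies [p] with [s], and the bits of [s] decide about the still older positions.
    The result is a canonical name of the point. *)
Fixpoint chase D p ps :=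
  if ps is s :: ps' then chase D (if same_bit D p s then s else p) ps' else p.

Fixpoint element D env x :=
  if env is (y, q) :: env' then
    if x == y then chase D q (unzip2 env') else element D env' x
  else 0.

Definition flat_index t := foldl (fun a i => a * n + i) 0 t.

(** The maximum, written with truncated subtraction because the evaluator computes it by an
    [expr]. *)
Definition top t := foldl (fun a i => i + (a - i)) 0 t.

Definition lookup D (r : tau) t : A :=
  (digit (D (top t * L + flat_index t))).2 r.

Definition set_block D q (f : {ffun 'I_L -> S}) k :=
  if q * L <= k then oapp f (D k) (insub (k - q * L)) else D k.

Definition args_offset (I : Type) (f : I -> seq (letter A tau)) (s : seq I) i :=
  size (flatten (take i [seq f j | j <- s])).

(** The position in the word is threaded through because it names points and blocks; the recursion
    thus reads the same cells of [D] as the machine. *)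
Fixpoint sure_value (phi : formula A tau) pos env D : A :=
  match phi with
  | Atom r xs => lookup D r [seq element D env x | x <- xs]
  | Meet phi psi => (sure_value phi pos.+1 env D `&`
      sure_value psi (pos.+1 + size (encode phi)) env D)%O
  | Join phi psi => (sure_value phi pos.+1 env D `|`
      sure_value psi (pos.+1 + size (encode phi)) env D)%O
  | Op o args => oper_fun [tuple sure_value (args i)
      (pos.+1 + args_offset (fun j => encode (args j)) (enum 'I_(oper_arity o)) i)
      env D | i < oper_arity o]
  | All x phi => (\meet_(f : {ffun 'I_L -> S}) sure_value phi
      (pos.+1 + size (@encode_var _ A tau x)) ((x, pos) :: env) (set_block D pos f))%O
  | Ex x phi => (\join_(f : {ffun 'I_L -> S}) sure_value phi
      (pos.+1 + size (@encode_var _ A tau x)) ((x, pos) :: env) (set_block D pos f))%O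
  end.

(** The positions whose string introduced a new point: one name for each distinct point chosen so
    far. *)
Fixpoint roots D ps :=
  if ps is s :: ps' then
    if chase D s ps' == s then s :: roots D ps' else roots D ps'
  else [::].

Lemma roots_sub D ps : {subset roots D ps <= ps}.
Proof.
elim: ps => //= s ps IH x; rewrite inE; case: ifP => _; rewrite ?inE.
  by case/orP=> [->//|/IH ->]; rewrite orbT.
by move/IH->; rewrite orbT.
Qed.

Lemma size_roots D ps : size (roots D ps) <= size ps.
Proof. by elim: ps => //= s ps IH; case: ifP => _ /=; lia. Qed.

Lemma roots_uniq D ps : uniq ps -> uniq (roots D ps).
Proof.
elim: ps => //= s ps IH /andP[sn /IH u]; case: ifP => //= _; rewrite u andbT.
by apply: contra sn => /roots_sub.
Qed.

Lemma chase_roots D p ps : chase D p ps = p \/ chase D p ps \in roots D ps.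
Proof.
elim: ps p => [|s ps IH] p /=; first by left.
case: (same_bit D p s); last first.
  by case: (IH p) => [->|h]; [left|right; case: ifP; rewrite // inE h orbT].
right; case: (IH s) => [e|h]; first by rewrite e eqxx inE eqxx.
by case: ifP; rewrite // inE h orbT.
Qed.

Lemma chase_none D p ps : {in ps, forall s, same_bit D p s = false} -> chase D p ps = p.
Proof.
elim: ps => //= s ps IH h; rewrite h ?mem_head //; apply: IH => x xs.
by apply: h; rewrite inE xs orbT.
Qed.

(** The single set bit leads to [q], and a root is not identified with anything older. *)
Lemma chase_hit D p q ps : uniq ps -> {in ps, forall s, same_bit D p s = (s == q)} ->
  q \in roots D ps -> chase D p ps = q.
Proof.
elim: ps => //= s ps IH /andP[sn u] h; rewrite h ?mem_head //.
case: (eqVneq s q) => [sq|nq]; last first.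
  move=> qr; apply: IH => // [x xs|]; first by apply: h; rewrite inE xs orbT.
  by move: qr; case: ifP => // _; rewrite inE eq_sym (negbTE nq).
case: ifP => [/eqP -> //|_ /roots_sub]; by rewrite -sq (negbTE sn).
Qed.

Lemma decreasing_lt q ps : path gtn q ps -> {in ps, forall s, s < q}.
Proof.
move=> h s sps; move: (order_path_min (rev_trans ltn_trans) h).
by move/allP/(_ s sps).
Qed.

Lemma decreasing_uniq q ps : path gtn q ps -> uniq ps.
Proof.
elim: ps q => //= s ps IH q /andP[_ h]; rewrite (IH s) // andbT.
by apply/negP => /(decreasing_lt h); rewrite ltnn.
Qed.

Lemma decreasing_size q ps : path gtn q ps -> size ps <= q.
Proof. by elim: ps q => //= s ps IH q /andP[sq /IH] h; move: sq; rewrite /=; lia. Qed.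

Lemma set_block_low D q f k : k < q * L -> set_block D q f k = D k.
Proof. by rewrite /set_block ltnNge => /negbTE ->. Qed.

Lemma set_block_in D q f (i : 'I_L) : set_block D q f (q * L + i) = f i.
Proof. by rewrite /set_block leq_addr addKn valK. Qed.

Section Agree.
Variables (D D' : nat -> S) (q : nat).
Hypothesis agree : forall k, k < q * L -> D' k = D k.
Hypothesis qL : q <= L.

(** Since [s < q <= L], the bit lies inside block [p], hence below [q * L]. *)
Lemma same_bit_agree p s : p < q -> s < q -> same_bit D' p s = same_bit D p s.
Proof. by move=> pq sq; rewrite /same_bit agree //; nia. Qed.

Lemma chase_agree p ps : p < q -> {in ps, forall s, s < q} -> chase D' p ps = chase D p ps.
Proof.
elim: ps p => //= s ps IH p pq h; have sq := h s (mem_head _ _).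
rewrite same_bit_agree // IH //; first by case: ifP.
by move=> x xs; apply: h; rewrite inE xs orbT.
Qed.

Lemma roots_agree ps : {in ps, forall s, s < q} -> roots D' ps = roots D ps.
Proof.
elim: ps => //= s ps IH h.
have h' : {in ps, forall s, s < q} by move=> x xs; apply: h; rewrite inE xs orbT.
by rewrite IH // chase_agree // h // mem_head.
Qed.

Lemma element_agree env x : {in unzip2 env, forall s, s < q} ->
  element D' env x = element D env x.
Proof.
elim: env => //= -[y p] env IH /= h.
have h' : {in unzip2 env, forall s, s < q} by move=> i xs; apply: h; rewrite inE xs orbT.
by rewrite IH // chase_agree // h // mem_head.
Qed.

End Agree.

Lemma element_roots D env x : x \in unzip1 env -> element D env x \in roots D (unzip2 env).
Proof.
elim: env => //= -[y q] env IH /=; rewrite inE; case: (eqVneq x y) => [_ _|_ /= /IH].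
  by have [->|] := chase_roots D q (unzip2 env); rewrite ?eqxx ?mem_head //;
    case: ifP => // _ h; rewrite inE h orbT.
by case: ifP => // _ h; rewrite inE h orbT.
Qed.

Lemma top_rcons t i : top (rcons t i) = maxn i (top t).
Proof. by rewrite /top foldl_rcons; rewrite maxnE. Qed.

Lemma top_lt t q : 0 < q -> {in t, forall i, i < q} -> top t < q.
Proof.
move=> q0; elim/last_ind: t => //= t i IH h; rewrite top_rcons gtn_max h ?mem_rcons ?mem_head //=.
by apply: IH => j jt; apply: h; rewrite mem_rcons inE jt orbT.
Qed.

Lemma top_eq t q : q \in t -> {in t, forall i, i <= q} -> top t = q.
Proof.
elim/last_ind: t => //= t i IH; rewrite top_rcons mem_rcons inE => qt h.
have ht : {in t, forall i, i <= q} by move=> j jt; apply: h; rewrite mem_rcons inE jt orbT.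
have iq : i <= q by apply: h; rewrite mem_rcons mem_head.
case/orP: qt => [/eqP <-|/IH -> //]; last by apply/maxn_idPr.
by apply/maxn_idPl; rewrite -ltnS; apply: top_lt => // j /ht; rewrite ltnS.
Qed.

Lemma flat_rcons t i : flat_index (rcons t i) = flat_index t * n + i.
Proof. by rewrite /flat_index foldl_rcons. Qed.

Lemma flat_lt t : {in t, forall i, i < n} -> flat_index t < n ^ size t.
Proof.
elim/last_ind: t => //= t i IH h; rewrite flat_rcons size_rcons expnS.
have hi : i < n by apply: h; rewrite mem_rcons mem_head.
have {}IH : flat_index t < n ^ size t.
  by apply: IH => j jt; apply: h; rewrite mem_rcons inE jt orbT.
nia.
Qed.

Lemma flat_inj t t' : size t = size t' -> {in t, forall i, i < n} ->
  {in t', forall i, i < n} -> flat_index t = flat_index t' -> t = t'.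
Proof.
elim/last_ind: t t' => [|t i IH] t'; first by case: t'.
case: (lastP t') => [|{}t' i']; rewrite !size_rcons // => -[st] h h'.
have hi : i < n by apply: h; rewrite mem_rcons mem_head.
have hi' : i' < n by apply: h'; rewrite mem_rcons mem_head.
rewrite !flat_rcons => e.
have ei : i = i'.
  by move: (congr1 (modn^~ n) e); rewrite !modnMDl !modn_small.
rewrite ei; congr rcons; apply: IH => //.
- by move=> j jt; apply: h; rewrite mem_rcons inE jt orbT.
- by move=> j jt; apply: h'; rewrite mem_rcons inE jt orbT.
by move: e; rewrite ei => /addIn /eqP; rewrite eqn_pmul2r ?(leq_ltn_trans _ hi) // => /eqP.
Qed.

Hypothesis nL : n <= L.
Hypothesis arityL : forall r : tau, n ^ rel_arity r <= L.
Variable encode_digit : bool * {ffun tau -> A} -> S.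
Hypothesis encode_digitK : cancel encode_digit digit.

(** The pattern [h] lives on indices into [s]; the fresh [e], not occurring in [s], has index [K].
    Only atoms containing [e] are prescribed. [s] may have repetitions, so one [K] serves all
    smaller configurations. *)
Definition extension K (T : finType) (M : structure A tau T) : bool :=
  [forall s : K.-tuple T, forall h : structure A tau 'I_K.+1,
    exists e : T, (e \notin s) &&
     [forall r : tau, forall t : (rel_arity r).-tuple T,
       (e \in t) ==> all (mem (e :: s)) t ==>
       (M r t == h r (map_tuple (fun y => inord (index y s)) t))]].

(** * Comparison with a structure having the extension property *)

Section Structure.
Variables (T : finType) (M : structure A tau T) (x0 : T).
Hypothesis extM : extension n M.

(** The invariant of the comparison: [g] interprets the names in [M], faithfully on the roots, and
    [D] records the atomic diagram of the named points. *)
Record fits D env (g : nat -> T) (v : nat -> T) pos : Prop := Fits {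
  fits_path : path gtn pos (unzip2 env);
  fits_inj : {in roots D (unzip2 env) &, injective g};
  fits_val : {in unzip1 env, forall x, v x = g (element D env x)};
  fits_atom : forall r (t : (rel_arity r).-tuple nat),
    {in t, forall i, i \in roots D (unzip2 env)} -> M r (map_tuple g t) = lookup D r t
}.

(** Positive arity makes [t] nonempty, so [q] is positive and the maximum of [t] is below [q]: the
    digit read lies in an older block. *)
Lemma lookup_agree D D' q r (t : (rel_arity r).-tuple nat) : q <= n ->
  (forall k, k < q * L -> D' k = D k) -> {in t, forall i, i < q} ->
  lookup D' r t = lookup D r t.
Proof.
move=> qn agree h; rewrite /lookup agree //.
have q0 : 0 < q.
  by have := h _ (mem_tnth (Ordinal (rel_arity_gt0 r)) t); lia.
have := top_lt q0 h; have : flat_index t < n ^ size t.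
  by apply: flat_lt => i /h; lia.
rewrite size_tuple; move/leq_trans/(_ (arityL r)).
by move: (top t) (flat_index t) => a b; nia.
Qed.

Section Extend.
Variables (D : nat -> S) (env : seq (nat * nat)) (g v : nat -> T) (q : nat).
Hypothesis fit : fits D env g v q.
Hypothesis qn : q < n.
Let ps := unzip2 env.

(** Choosing an older point adds no root, so neither [g] nor the recorded diagram changes. *)
Lemma fits_copy D' x e p pos : (forall k, k < q * L -> D' k = D k) ->
  chase D' q ps = p -> p != q -> e = g p -> q < pos ->
  fits D' ((x, q) :: env) g (update v x e) pos.
Proof.
move=> agree hp pq ep qpos; have [hpath hinj hval hatom] := fit.
have lt := decreasing_lt hpath; have qL : q <= L by lia.
have er : roots D' (unzip2 ((x, q) :: env)) = roots D ps.
  by rewrite /= -/ps hp (negbTE pq) (roots_agree agree).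
split; rewrite ?er //.
- by rewrite /= qpos.
- move=> y; rewrite inE /= /update; case: (eqVneq y x) => [_ _|_ /=]; first by rewrite -/ps hp.
  by move=> yenv; rewrite (element_agree agree) // hval.
- move=> r t h; rewrite (@lookup_agree D _ q) // ?hatom //; first lia.
  by move=> i /h /roots_sub /lt.
Qed.

Lemma fits_new D' x e pos : (forall k, k < q * L -> D' k = D k) ->
  chase D' q ps = q -> e \notin [seq g p | p <- roots D ps] -> q < pos ->
  (forall r (t : (rel_arity r).-tuple nat), q \in (t : seq nat) ->
     {in t, forall i, i \in q :: roots D ps} ->
     M r (map_tuple (fun i => if i == q then e else g i) t) = lookup D' r t) ->
  fits D' ((x, q) :: env) (fun i => if i == q then e else g i) (update v x e) pos.
Proof.
move=> agree hq en qpos hnew; have [hpath hinj hval hatom] := fit.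
have lt := decreasing_lt hpath; have qL : q <= L by lia.
have er : roots D' (unzip2 ((x, q) :: env)) = q :: roots D ps.
  by rewrite /= -/ps hq eqxx (roots_agree agree).
have ne i : i \in roots D ps -> (i == q) = false.
  by move=> /roots_sub /lt iq; apply/eqP => e'; rewrite e' ltnn in iq.
split; rewrite ?er //.
- by rewrite /= qpos.
- move=> i j; rewrite !inE; case: (eqVneq i q) => [->|iq] /=; case: (eqVneq j q) => [->|jq] //=.
  + by move=> _ jr ee; case/negP: en; rewrite ee map_f.
  + by move=> ir _ ee; case/negP: en; rewrite -ee map_f.
  + exact: hinj.
- move=> y; rewrite inE /= /update; case: (eqVneq y x) => [_ _|_ /=]; first by rewrite -/ps hq eqxx.
  by move=> yenv; rewrite (element_agree agree) // ne ?hval // element_roots.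
- move=> r t h; case: (boolP (q \in (t : seq nat))) => qt; first exact: hnew.
  have ht : {in t, forall i, i \in roots D ps}.
    by move=> i it; have := h i it; rewrite inE => /orP[/eqP e'|//]; rewrite -e' it in qt.
  rewrite (@lookup_agree D _ q) // ?hatom //; first 1 last; first lia.
    by move=> i /ht /roots_sub /lt.
  rewrite -hatom //; congr (M r _); apply: eq_from_tnth => i; rewrite !tnth_map ne //.
  by apply: ht; apply: mem_tnth.
Qed.

(** Every point is described by some string: an older one by the single bit at its root, a new one
    by its atoms with no bit set. The extension property plays no part in this direction. *)
Lemma fits_choice x e pos : q < pos -> exists (f : {ffun 'I_L -> S}) g',
  fits (set_block D q f) ((x, q) :: env) g' (update v x e) pos.
Proof.
move=> qpos; have [hpath hinj hval hatom] := fit; have lt := decreasing_lt hpath.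
have qL : q <= L by lia.
have agree f k : k < q * L -> set_block D q f k = D k by exact: set_block_low.
case: (boolP (e \in [seq g p | p <- roots D ps])) => [/mapP[p pr ep]|en].
  pose f : {ffun 'I_L -> S} := [ffun i : 'I_L => encode_digit (val i == p, [ffun=> \bot%O])].
  exists f, g; apply: (@fits_copy _ _ _ p _ (agree f)) => //; last first.
    by apply/eqP => pq; have := lt _ (roots_sub pr); rewrite pq ltnn.
  apply: chase_hit; first exact: decreasing_uniq hpath.
    move=> s sps; have sL : s < L by have := lt s sps; lia.
    by rewrite /same_bit (set_block_in D q f (Ordinal sL)) ffunE encode_digitK.
  by rewrite (roots_agree (agree f)).
pose g' i := if i == q then e else g i.
(* Digit [i] is decoded into the tuple of index [i], separately for each arity; where there is none,
   the value [\bot] is arbitrary. *)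
pose f : {ffun 'I_L -> S} := [ffun i : 'I_L => encode_digit (false, [ffun r =>
  if [pick t : (rel_arity r).-tuple 'I_n | flat_index (map val t) == i] is Some t
  then M r (map_tuple (g' \o val) t) else \bot%O])].
exists f, g'; apply: (@fits_new _ _ _ _ (agree f)) => //.
  apply: chase_none => s sps; have sL : s < L by have := lt s sps; lia.
  by rewrite /same_bit (set_block_in D q f (Ordinal sL)) ffunE encode_digitK.
move=> r t qt ht; have tn : {in t, forall i, i < n}.
  by move=> i /ht; rewrite inE => /orP[/eqP ->//|/roots_sub /lt]; lia.
have fL : flat_index t < L.
  by apply: leq_trans (arityL r); rewrite -{2}(size_tuple t); apply: flat_lt.
rewrite /lookup (top_eq qt); last first.
  by move=> i /ht; rewrite inE => /orP[/eqP ->//|/roots_sub /lt]; lia.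
rewrite (set_block_in D q f (Ordinal fL)) ffunE encode_digitK ffunE /=.
case: pickP => [u /eqP eu|no]; last first.
  have n0 : 0 < n by lia.
  pose u := map_tuple (fun i => insubd (Ordinal n0) i) t.
  case/negP: (negbT (no u)); apply/eqP; congr flat_index.
  rewrite -map_comp -[RHS]map_id; apply/eq_in_map => i it /=.
  by rewrite val_insubd tn.
(* The picked tuple has the index of [t], and indices are injective on tuples of entries below
   [n]. *)
have e' : map val u = t.
  apply: flat_inj => //; first by rewrite size_map !size_tuple.
  by move=> i /mapP[j _ ->]; apply: ltn_ord.
congr (M r _); apply: val_inj => /=; rewrite -{1}e' -map_comp //.
Qed.

(** Every string is realized by some point: the one it is chased to, or a fresh one supplied by the
    extension property. *)
Lemma fits_extension x pos f : q < pos -> exists e g',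
  fits (set_block D q f) ((x, q) :: env) g' (update v x e) pos.
Proof.
move=> qpos; have [hpath hinj hval hatom] := fit; have lt := decreasing_lt hpath.
have qL : q <= L by lia.
have agree k : k < q * L -> set_block D q f k = D k by exact: set_block_low.
set D' := set_block D q f in agree *.
case: (eqVneq (chase D' q ps) q) => [hq|nq]; last first.
  by exists (g (chase D' q ps)), g; apply: (@fits_copy D' x _ (chase D' q ps) pos agree).
pose rho := roots D ps; have srho : size rho <= n.
  by have := size_roots D ps; have := decreasing_size hpath; rewrite -/ps /rho; lia.
(* [extension n] asks for exactly [n] points. The padding goes to the end, where it does not disturb
   the indices of the images of roots. *)
have ss : size ([seq g p | p <- rho] ++ nseq (n - size rho) x0) == n.
  by rewrite size_cat size_map size_nseq; apply/eqP; lia.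
pose s := Tuple ss.
(* Translates indices back to names, [n] being the index of the fresh point; [h] is the pattern that
   the string prescribes. *)
pose dec (k : 'I_n.+1) := if k < n then nth 0 rho k else q.
pose h : structure A tau 'I_n.+1 := [ffun r : tau => [ffun u : (rel_arity r).-tuple 'I_n.+1 => lookup D' r (map dec u)]
  : {ffun (rel_arity r).-tuple 'I_n.+1 -> A}].
move/forallP/(_ s)/forallP/(_ h)/existsP: extM => [e /andP[en /forallP hM]].
have en' : e \notin [seq g p | p <- rho].
  by apply: contra en => er; rewrite mem_cat er.
exists e, (fun i => if i == q then e else g i); apply: (@fits_new _ _ _ _ agree) => // r t qt ht.
move/forallP/(_ (map_tuple (fun i => if i == q then e else g i) t)): (hM r).
have ne i : i \in rho -> (i == q) = false.
  by move=> /roots_sub /lt iq; apply/eqP => e'; rewrite e' ltnn in iq.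
have -> : e \in map_tuple (fun i => if i == q then e else g i) t.
  by apply/mapP; exists q; rewrite ?eqxx.
have -> : all (mem (e :: s)) (map_tuple (fun i => if i == q then e else g i) t).
  apply/allP => _ /mapP[i /ht + ->]; rewrite !inE => /orP[/eqP ->|ir]; first by rewrite !eqxx.
  by rewrite ne // mem_cat map_f // orbT.
move=> /= /eqP ->; rewrite !ffunE; congr (lookup D' r).
rewrite /= -!map_comp -[RHS]map_id; apply/eq_in_map => i /ht /=; rewrite inE /dec.
case: (eqVneq i q) => [-> _|_ /= ir].
  rewrite inordK; last by rewrite ltnS -{2}(eqP ss) index_size.
  have -> : index e s = n by rewrite -[RHS](eqP ss); apply: memNindex.
  by rewrite ltnn.
have us : uniq [seq g p | p <- rho].
  rewrite map_inj_in_uniq; last exact: hinj.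
  by apply: roots_uniq; apply: decreasing_uniq hpath.
have ei : index (g i) s = index i rho.
  rewrite index_cat map_f // -[X in g X](nth_index 0 ir).
  by rewrite -(nth_map _ x0) ?index_mem // index_uniq // size_map index_mem.
have il : index i rho < n by apply: leq_trans srho; rewrite index_mem.
by rewrite ei inordK ?il ?nth_index //; lia.
Qed.

End Extend.

Lemma args_offset_lt (I : Type) (f : I -> seq (letter A tau)) s i0 i : i < size s ->
  args_offset f s i + size (f (nth i0 s i)) <= size (flatten (map f s)).
Proof.
rewrite /args_offset; elim: s i => //= j s IH [|i] h /=; rewrite !size_cat; first lia.
by have := IH i h; lia.
Qed.

(** At a quantifier, points and strings produce the same set of values by [fits_choice] and
    [fits_extension]. The bound on the length keeps every position below [n]. *)
Theorem value_sure phi pos env D g v : fits D env g v pos ->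
  {subset free_vars phi <= unzip1 env} -> pos + size (encode phi) <= n ->
  value M v phi = sure_value phi pos env D.
Proof.
elim: phi pos env D g v => [r xs|phi IH1 psi IH2|phi IH1 psi IH2|o args IH|x phi IH|x phi IH]
  pos env D g v fit /= fv; rewrite ?size_cat => sn.
- rewrite -[RHS](@fits_atom _ _ _ _ _ fit r (map_tuple (element D env) xs)).
    congr (M r _); apply: eq_from_tnth => i; rewrite !tnth_map.
    by apply: (fits_val fit); apply: fv; apply: mem_tnth.
  by move=> _ /mapP[x /fv xe ->]; apply: element_roots.
- rewrite (IH1 pos.+1 env D g) ?(IH2 (pos.+1 + size (encode phi)) env D g) //; try lia.
  + by case: fit => h *; split=> //; case: (unzip2 env) h => //= a b; lia.
  + by move=> y yf; apply: fv; rewrite mem_cat yf orbT.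
  + by case: fit => h *; split=> //; case: (unzip2 env) h => //= a b; lia.
  + by move=> y yf; apply: fv; rewrite mem_cat yf.
- rewrite (IH1 pos.+1 env D g) ?(IH2 (pos.+1 + size (encode phi)) env D g) //; try lia.
  + by case: fit => h *; split=> //; case: (unzip2 env) h => //= a b; lia.
  + by move=> y yf; apply: fv; rewrite mem_cat yf orbT.
  + by case: fit => h *; split=> //; case: (unzip2 env) h => //= a b; lia.
  + by move=> y yf; apply: fv; rewrite mem_cat yf.
- congr oper_fun; apply: eq_from_tnth => i; rewrite !tnth_mktuple; apply: (IH i _ _ _ g).
  + by case: fit => h *; split=> //; case: (unzip2 env) h => //= a b; lia.
  + move=> y yf; apply: fv; apply/flatten_mapP; exists i => //.
    by rewrite mem_enum.
  + have := @args_offset_lt _ (fun j => encode (args j)) (enum 'I_(oper_arity o)) i i.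
    by rewrite size_enum_ord nth_ord_enum => /(_ (ltn_ord i)); lia.
- have qn : pos < n by lia.
  set pos' := pos.+1 + _; have qp : pos < pos' by rewrite /pos'; lia.
  have fv' : {subset free_vars phi <= x :: unzip1 env}.
    by move=> y yf; rewrite inE; case: eqP => //= /eqP yx; apply: fv; rewrite mem_filter yx.
  apply: eq_meet_image => [e|f].
    have [f [g' fit']] := fits_choice fit qn x e qp; exists f.
    by apply: IH fit' _ _ => //=; rewrite /pos'; lia.
  have [e [g' fit']] := fits_extension fit qn x f qp; exists e.
  by apply: IH fit' _ _ => //=; rewrite /pos'; lia.
- have qn : pos < n by lia.
  set pos' := pos.+1 + _; have qp : pos < pos' by rewrite /pos'; lia.
  have fv' : {subset free_vars phi <= x :: unzip1 env}.
    by move=> y yf; rewrite inE; case: eqP => //= /eqP yx; apply: fv; rewrite mem_filter yx.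
  apply: eq_join_image => [e|f].
    have [f [g' fit']] := fits_choice fit qn x e qp; exists f.
    by apply: IH fit' _ _ => //=; rewrite /pos'; lia.
  have [e [g' fit']] := fits_extension fit qn x f qp; exists e.
  by apply: IH fit' _ _ => //=; rewrite /pos'; lia.
Qed.

(** The right side mentions neither [M] nor its domain: this is the common value of all structures
    with the extension property. *)
Corollary sentence_value phi v D : sentence phi -> size (encode phi) <= n ->
  value M v phi = sure_value phi 0 [::] D.
Proof.
move=> /nilP s sn; apply: (@value_sure _ _ _ _ (fun=> x0)) => //; last by rewrite s.
split=> // r t; by move=> /(_ _ (mem_tnth (Ordinal (rel_arity_gt0 r)) t)).
Qed.

End Structure.
End Evaluation.

(** * The evaluator *)

Import Order.LTheory.

(** * Counting through digit strings *)

Section Numerals.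
Variable b : nat.

Lemma big_expn L (f : nat -> nat) :
  \sum_(i < L.+1) f i * b ^ i = f 0 + (\sum_(i < L) f i.+1 * b ^ i) * b.
Proof.
rewrite big_ord_recl expn0 muln1 big_distrl /=; congr (_ + _).
by apply: eq_bigr => i _; rewrite /bump add1n expnS; lia.
Qed.

Lemma numeral_inj L (f g : nat -> nat) :
  (forall i, f i < b) -> (forall i, g i < b) ->
  \sum_(i < L) f i * b ^ i = \sum_(i < L) g i * b ^ i ->
  forall i, i < L -> f i = g i.
Proof.
elim: L f g => // L IH f g fb gb; rewrite !big_expn => e.
have e0 : f 0 = g 0.
  by move: (congr1 (modn^~ b) e); rewrite /= ![_ 0 + _]addnC !modnMDl !modn_small.
have b0 : 0 < b by have := fb 0; lia.
move: e; rewrite e0 => /addnI /eqP; rewrite eqn_pmul2r // => /eqP e.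
case=> [|i] iL //; by apply: (IH (f \o succn) (g \o succn)) => // j; [apply: fb|apply: gb].
Qed.

(** The carry: the rolled-over digits below [c] lose [b ^ c - 1], and digit [c] gains [b ^ c]. *)
Lemma numeral_succ L c (f g : nat -> nat) : c < L ->
  (forall i, i < c -> f i = b.-1 /\ g i = 0) -> 0 < b ->
  g c = (f c).+1 -> (forall i, c < i < L -> g i = f i) ->
  \sum_(i < L) g i * b ^ i = (\sum_(i < L) f i * b ^ i).+1.
Proof.
elim: L c f g => // L IH c f g cL lo b0 gc hi; rewrite !big_expn.
case: c cL lo gc hi => [|c] cL lo gc hi.
  rewrite gc addSn; congr ((_ + _ * _).+1).
  by apply: eq_bigr => i _; rewrite hi //= ltnS ltn_ord.
have [-> ->] := lo 0 isT.
rewrite (IH c (f \o succn) (g \o succn)) //=; last 2 first.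
- by move=> i ic; apply: lo.
- by move=> i ic; apply: hi.
by nia.
Qed.

End Numerals.

Section Digits.
Variables (S : finType) (x0 : S).

(* Every tape symbol serves as a digit, so that with [x0] the blank an unused
   block already holds the numeral 0. *)
Definition symbols : seq S := x0 :: [seq x <- enum S | x != x0].

Definition rank (x : S) := index x symbols.

Definition next (x : S) : option S :=
  if (rank x).+1 < size symbols then Some (nth x0 symbols (rank x).+1) else None.

Lemma mem_symbols x : x \in symbols.
Proof. by rewrite inE mem_filter mem_enum andbT; case: eqP. Qed.

Lemma rank_lt x : rank x < size symbols.
Proof. by rewrite index_mem mem_symbols. Qed.

Lemma rank0 : rank x0 = 0.
Proof. by rewrite /rank /= eqxx. Qed.

Lemma rank_inj : injective rank.
Proof.
by move=> x y e; rewrite -(nth_index x0 (mem_symbols x)) -/(rank x) e nth_index ?mem_symbols.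
Qed.

Lemma next_some x y : next x = Some y -> rank y = (rank x).+1.
Proof.
rewrite /next; case: ifP => // h /Some_inj <-; rewrite /rank index_uniq //=.
by rewrite filter_uniq ?enum_uniq // mem_filter eqxx.
Qed.

Lemma next_none x : next x = None -> rank x = (size symbols).-1.
Proof. by rewrite /next; case: ifP => // h _; have := rank_lt x; lia. Qed.

Variable L : nat.
Implicit Types f g : {ffun 'I_L -> S}.

(** Orders the strings as the odometer visits them; it serves as the termination measure and tells
    the strings still to come. *)
Definition numeral f := \sum_(i < L) rank (f i) * size symbols ^ i.

Lemma numeral_ffun_inj : injective numeral.
Proof.
move=> f g e; apply/ffunP => i; apply: rank_inj.
have i0 : 0 < L by apply: leq_ltn_trans (ltn_ord i).
pose h (f : {ffun 'I_L -> S}) k := rank (f (insubd (Ordinal i0) k)).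
have hE f' (j : 'I_L) : h f' j = rank (f' j).
  by rewrite /h; congr (rank (f' _)); apply: val_inj; rewrite val_insubd ltn_ord.
rewrite -!hE; apply: (@numeral_inj (size symbols) L) => // [k|k|]; try exact: rank_lt.
rewrite /numeral in e; move: e.
by under eq_bigr do rewrite -hE; under [RHS]eq_bigr do rewrite -hE.
Qed.

Lemma numeral_next f g (c : 'I_L) : (forall i : 'I_L, i < c -> next (f i) = None /\ g i = x0) ->
  next (f c) = Some (g c) -> (forall i : 'I_L, c < i -> g i = f i) ->
  numeral g = (numeral f).+1.
Proof.
move=> lo fc hi; have i0 : 0 < L by apply: leq_ltn_trans (ltn_ord c).
pose h (f : {ffun 'I_L -> S}) k := rank (f (insubd (Ordinal i0) k)).
have hE f' (j : 'I_L) : h f' j = rank (f' j).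
  by rewrite /h; congr (rank (f' _)); apply: val_inj; rewrite val_insubd ltn_ord.
rewrite /numeral; under eq_bigr do rewrite -hE; under [in RHS]eq_bigr do rewrite -hE.
have toord i : i < L -> i = insubd (Ordinal i0) i :> nat by move=> iL; rewrite val_insubd iL.
apply: (@numeral_succ _ L c) => //.
- move=> i ic; have [e1 e2] : next (f (insubd (Ordinal i0) i)) = None /\
      g (insubd (Ordinal i0) i) = x0 by apply: lo; rewrite -toord //; have := ltn_ord c; lia.
  by rewrite /h e2 rank0 (next_none e1).
- by rewrite !hE (next_some fc).
- by move=> i /andP[ci iL]; rewrite /h hi // -toord.
Qed.

Lemma numeral_max f g : (forall i, next (f i) = None) -> numeral g <= numeral f.
Proof.
move=> h; apply: leq_sum => i _; rewrite leq_mul2r (next_none (h i)).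
by have := rank_lt (g i); lia.
Qed.

End Digits.

(** * The program of the evaluator *)

Section Machine.
Variables (disp : Order.disp_t) (A : latticeAlgebra disp) (tau : vocabulary).

(** The 2 is for meet and join; a bound is needed because a frame is a single letter of a finite
    alphabet. *)
Definition max_args := maxn 2 (\max_(o : oper A) oper_arity o).

(* Besides the mark: the frame of an operation (the values of its first
   arguments), the frame of a quantifier (its running infimum or supremum), and
   the digits of the choice strings. *)
Definition work_letter : finType :=
  (max_args.-bseq A + A + (bool * {ffun tau -> A}) + unit)%type.

Notation lett := (letter A tau : finType).
Definition cell_symbol : finType := option (lett + work_letter).
Notation sym := cell_symbol.

Definition op_frame (s : max_args.-bseq A) : sym := Some (inr (inl (inl (inl s)))).
Definition quant_frame (a : A) : sym := Some (inr (inl (inl (inr a)))).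
Definition encode_digit (x : bool * {ffun tau -> A}) : sym := Some (inr (inl (inr x))).
Definition mark : work_letter := inr tt.

(** Symbols that are no digits, the blank among them, read as a clear bit and [\bot], so every
    string over the tape alphabet is a choice string. *)
Definition digit (x : sym) : bool * {ffun tau -> A} :=
  if x is Some (inr (inl (inr y))) then y else (false, [ffun=> \bot%O]).

Lemma encode_digitK : cancel encode_digit digit.
Proof. by []. Qed.

Definition is_quant (x : sym) : bool :=
  if x is Some (inr (inl (inl (inr _)))) then true else false.

Definition is_bit (x : sym) : bool := if x is Some (inl (LBit _)) then true else false.

Definition arity (l : lett) : nat :=
  match l with LMeet | LJoin => 2 | LOp o => oper_arity o | _ => 0 end.

Definition apply_op (l : lett) (s : seq A) : A :=
  match l with
  | LMeet => (nth \bot s 0 `&` nth \bot s 1)%O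
  | LJoin => (nth \bot s 0 `|` nth \bot s 1)%O
  | LOp o => oper_fun [tuple nth \bot%O s i | i < oper_arity o]
  | _ => \bot%O
  end.

Definition quant_start (l : lett) : A := if l is LAll then \top%O else \bot%O.

Definition quant_op (l : lett) (a b : A) : A :=
  if l is LAll then (a `&` b)%O else (a `|` b)%O.

Notation ntapes := 20 (only parsing).
Notation first_scratch := 14 (only parsing).
Notation prog := (prog lett work_letter ntapes).
Notation pret E e := (@pret lett work_letter ntapes E e).
Notation assign i e := (passign lett mark ntapes first_scratch i e).
Notation test e := (ptest lett mark ntapes first_scratch e).
Notation read a e := (pread lett mark ntapes first_scratch a e).
Notation store a e x := (pstore mark ntapes first_scratch a e x).
Notation "x + y" := (Plus x y) : expr_scope.
Notation "x * y" := (Times x y) : expr_scope.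
Notation "x - y" := (Minus x y) : expr_scope.
Delimit Scope expr_scope with X.

(* N, L: length of the word and of a block; p: current position; q: position of
   a frame; s, t: positions of quantifiers; i, j: cursors of [same_var]; x, m:
   flat index and maximum of a tuple of points; c: cursor in a block. *)
Notation rN := (Reg 3).
Notation rL := (Reg 4).
Notation rp := (Reg 5).
Notation rq := (Reg 6).
Notation rs := (Reg 7).
Notation rt := (Reg 8).
Notation ri := (Reg 9).
Notation rj := (Reg 10).
Notation rx := (Reg 11).
Notation rm := (Reg 12).
Notation rc := (Reg 13).

Definition skip_bits : prog unit :=
  ploop (fun _ : unit => x <~ read 0 rp ;;
    if is_bit x then assign 5 (rp + Cst 1)%X ;; pret (unit + unit)%type (inl tt)
    else pret (unit + unit)%type (inr tt)) tt.

(** The cursors start on two [LVar] letters and advance before each comparison; the variables agree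
    if the numerals end together. *)
Definition same_var : prog bool :=
  b <~ ploop (fun _ : unit => assign 9 (ri + Cst 1)%X ;; assign 10 (rj + Cst 1)%X ;;
    x <~ read 0 ri ;; y <~ read 0 rj ;;
    pret (unit + bool)%type (if is_bit x then if x == y then inl tt else inr false
      else inr (~~ is_bit y))) tt ;;
  assign 9 (Cst 0) ;; assign 10 (Cst 0) ;; pret bool b.

(** One leftward scan over the quantifier frames with two modes: it looks for the innermost binder
    of the variable at [p], then continues from there as [chase]. *)
Definition find_loop : bool -> prog unit :=
  ploop (fun chasing : bool => e <~ test rs ;;
    if e then pret (bool + unit)%type (inr tt) else
    assign 7 (rs - Cst 1)%X ;; f <~ read 1 rs ;;
    if is_quant f then
      if chasing then
        x <~ read 2 (rt * rL + rs)%X ;;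
        if (digit x).1 then assign 8 rs ;; pret (bool + unit)%type (inl true)
        else pret (bool + unit)%type (inl true)
      else
        assign 9 (rs + Cst 1)%X ;; assign 10 rp ;; b <~ same_var ;;
        if b then assign 8 rs ;; pret (bool + unit)%type (inl true)
        else pret (bool + unit)%type (inl false)
    else pret (bool + unit)%type (inl chasing)).

Definition find_element : prog unit := assign 7 rp ;; find_loop false.

Fixpoint eval_args k : prog unit :=
  if k is k'.+1 then
    find_element ;; assign 11 (rx * rN + rt)%X ;; assign 12 (rt + (rm - rt))%X ;;
    assign 8 (Cst 0) ;; assign 5 (rp + Cst 1)%X ;; skip_bits ;; eval_args k'
  else pret unit tt.

Definition eval_atom (r : tau) : prog A :=
  assign 5 (rp + Cst 1)%X ;; eval_args (rel_arity r) ;;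
  x <~ read 2 (rm * rL + rx)%X ;; assign 11 (Cst 0) ;; assign 12 (Cst 0) ;;
  pret A ((digit x).2 r).

(** The 2 skips the quantifier and [LVar]. The block needs no initialization, since a blank block is
    the numeral 0. *)
Definition enter_quant (l : lett) : prog (option A) :=
  store 1 rp (quant_frame (quant_start l)) ;; assign 5 (rp + Cst 2)%X ;; skip_bits ;;
  pret (option A) None.

(** A nullary operation gets no frame, as no argument would ever return to it. *)
Definition enter_op (l : lett) : prog (option A) :=
  if arity l == 0 then assign 5 (rp + Cst 1)%X ;; pret (option A) (Some (apply_op l [::]))
  else store 1 rp (op_frame (insub_bseq _ [::])) ;; assign 5 (rp + Cst 1)%X ;; pret (option A) None.

Definition enter : prog (option A) :=
  l <~ read 0 rp ;;
  match l with
  | Some (inl (LRel r)) => a <~ eval_atom r ;; pret (option A) (Some a)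
  | Some (inl LAll) => enter_quant (LAll A tau)
  | Some (inl LEx) => enter_quant (LEx A tau)
  | Some (inl l) => enter_op l
  | _ => pret (option A) None
  end.

(** The stack needs no pointer: frames sit at the positions of their letters and are erased when
    closed, so the innermost open one is the nearest nonblank cell to the left. *)
Definition frame_loop : unit -> prog sym :=
  ploop (fun _ : unit => e <~ test rq ;;
    if e then pret (unit + sym)%type (inr None) else
    assign 6 (rq - Cst 1)%X ;; f <~ read 1 rq ;;
    pret (unit + sym)%type (if f == None then inl tt else inr f)).

Definition find_frame : prog sym := assign 6 rp ;; frame_loop tt.

Definition choice_loop : unit -> prog bool :=
  ploop (fun _ : unit => e <~ test (rL - rc)%X ;;
    if e then pret (unit + bool)%type (inr false) else
    x <~ read 2 (rq * rL + rc)%X ;;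
    if next (None : sym) x is Some y then
      store 2 (rq * rL + rc)%X y ;; pret (unit + bool)%type (inr true)
    else store 2 (rq * rL + rc)%X None ;; assign 13 (rc + Cst 1)%X ;;
         pret (unit + bool)%type (inl tt)).

(* Passes to the next choice string of the quantifier at position q; from the
   last one back to the blank one, with result [false]. *)
Definition next_choice : prog bool :=
  b <~ choice_loop tt ;; assign 13 (Cst 0) ;; pret bool b.

Notation onward := (option A + A)%type.

Definition return_op (l : lett) (s : seq A) : prog onward :=
  if size s == arity l then
    store 1 rq None ;; assign 6 (Cst 0) ;; pret onward (inl (Some (apply_op l s)))
  else store 1 rq (op_frame (insub_bseq _ s)) ;; assign 6 (Cst 0) ;; pret onward (inl None).

Definition return_quant (acc : A) : prog onward :=
  b <~ next_choice ;;
  if b then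
    store 1 rq (quant_frame acc) ;; assign 5 (rq + Cst 2)%X ;; skip_bits ;;
    assign 6 (Cst 0) ;; pret onward (inl None)
  else store 1 rq None ;; assign 6 (Cst 0) ;; pret onward (inl (Some acc)).

Definition return_value (a : A) : prog onward :=
  f <~ find_frame ;; l <~ read 0 rq ;;
  match f, l with
  | Some (inr (inl (inl (inl s)))), Some (inl l) => return_op l (rcons s a)
  | Some (inr (inl (inl (inr acc)))), Some (inl l) => return_quant (quant_op l acc a)
  | _, _ => pret onward (inr a)
  end.

(** The loop variable is [None] when a subformula is to be entered at [p], and [Some a] when the one
    ending just before [p] has value [a]. *)
Definition main_loop : option A -> prog A :=
  ploop (fun m : option A =>
    if m is Some a then return_value a else m' <~ enter ;; pret onward (inl m')).

Fixpoint mark_registers (k i : nat) : prog unit :=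
  if k is k'.+1 then pwrite ntapes i (Some (inr mark)) ;; mark_registers k' i.+1
  else pret unit tt.

Fixpoint set_power m : prog unit :=
  if m is m'.+1 then assign 4 (rL * rN)%X ;; set_power m' else pret unit tt.

Definition evaluator m : prog A :=
  mark_registers 18 3 ;;
  ploop (fun _ : unit => x <~ read 0 rN ;;
    if x == None then pret (unit + unit)%type (inr tt)
    else assign 3 (rN + Cst 1)%X ;; pret (unit + unit)%type (inl tt)) tt ;;
  assign 4 (Cst 1) ;; set_power m ;; main_loop None.

(** * Correctness of the evaluator *)

Section Run.
Variables (W : nat -> sym) (N L B : nat).
Hypothesis W_end : forall i, N <= i -> W i = None.
Hypothesis N_gt0 : 0 < N.
Hypothesis N_le : N <= L.
Hypothesis arity_le : forall r : tau, N ^ rel_arity r <= L.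
Hypothesis B_ge : (N + 2) * (L + 2) <= B.

Notation st F D p q s t i j x m c :=
  (@ram lett work_letter mark W F D [:: 0; 0; 0; N; L; p; q; s; t; i; j; x; m; c]).
Notation wp := (wp B).
Implicit Types (F D : nat -> sym).

Lemma B_N : N + 4 <= B. Proof. by nia. Qed.
Lemma B_L : 3 * L + 4 <= B. Proof. by nia. Qed.
(** [L.+1] appears because [eval_bound] charges a product with the successor of its second
    factor. *)
Lemma B_index q c : q <= N -> c <= L -> q * L.+1 + c <= B.
Proof. by move=> qN cL; nia. Qed.

Ltac bound := rewrite /=; have ? := B_N; have ? := B_L; first [lia | apply: B_index; lia].
Ltac w_assign := apply: wp_assign; [by []|by []|by []|by []|by []|try bound|rewrite /=].
Ltac w_test := apply: wp_test; [by []|by []|by []|by []|try bound|rewrite /=].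
Ltac w_read := apply: wp_read; [by []|by []|by []|by []|by []|by []|try bound|rewrite /=].
Ltac w_store := apply: wp_store; [by []|by []|by []|by []|by []|by []|try bound|rewrite /=].
Ltac w_seq := apply: wp_bind.

Fixpoint word_at i (w : seq lett) : Prop :=
  if w is l :: w' then W i = Some (inl l) /\ word_at i.+1 w' else True.

Fixpoint bits_at i (bs : seq bool) : Prop :=
  if bs is b :: bs' then W i = Some (inl (LBit A tau b)) /\ bits_at i.+1 bs'
  else ~~ is_bit (W i).

Lemma word_at_cat i w1 w2 : word_at i (w1 ++ w2) <-> word_at i w1 /\ word_at (i + size w1) w2.
Proof.
elim: w1 i => [|l w1 IH] i /=; first by rewrite addn0; split=> [|[]].
by rewrite IH addSnnS; split=> [[? []]|[[]]].
Qed.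

Lemma word_bits_at i bs : word_at i [seq LBit A tau b | b <- bs] ->
  ~~ is_bit (W (i + size bs)) -> bits_at i bs.
Proof.
elim: bs i => [|b bs IH] i /=; first by rewrite addn0.
by case=> -> h; rewrite addnS -addSn => n; split=> //; apply: IH.
Qed.

Lemma bit_lt i : is_bit (W i) -> i < N.
Proof. by case: ltnP => // /W_end ->. Qed.

Lemma word_at_le i w : i <= N -> word_at i w -> i + size w <= N.
Proof.
elim: w i => [|l w IH] i iN /=; first by rewrite addn0.
case=> Wi /IH; rewrite addnS -addSn; apply.
by case: (ltnP i N) => // /W_end; rewrite Wi.
Qed.

Lemma bits_at_le i bs : i <= N -> bits_at i bs -> i + size bs <= N.
Proof.
elim: bs i => [|l w IH] i iN /=; first by rewrite addn0.
by case=> Wi /IH; rewrite addnS -addSn; apply; apply: bit_lt; rewrite Wi.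
Qed.

Lemma skip_bits_run F D p q s t i j x m c bs (Q : unit -> _ -> Prop) :
  bits_at p bs -> p <= N ->
  Q tt (st F D (p + size bs) q s t i j x m c) ->
  wp skip_bits (st F D p q s t i j x m c) Q.
Proof.
elim: bs p => [|b bs IH] p /= h pN q0; apply: wp_loop; w_seq; w_read.
  by rewrite (negbTE h); apply: wp_ret; rewrite addn0 in q0.
case: h => hW h; have pN' : p < N by apply: bit_lt; rewrite hW.
rewrite hW /=; w_seq; w_assign; apply: wp_ret; rewrite addn1.
by apply: IH => //; rewrite addSnnS.
Qed.

Lemma same_var_run F D p q s t i j x m c bs bs' (Q : bool -> _ -> Prop) :
  bits_at i.+1 bs -> bits_at j.+1 bs' -> i <= N -> j <= N ->
  Q (bs == bs') (st F D p q s t 0 0 x m c) ->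
  wp same_var (st F D p q s t i j x m c) Q.
Proof.
move=> h h' iN jN q0; w_seq.
(* The verdict gets a name so that the induction can strip equal bits while the continuation stays
   fixed. *)
have [r er] : {r | r = (bs == bs')} by exists (bs == bs').
have {q0} : forall i' j', wp (assign 9 (Cst 0) ;; assign 10 (Cst 0) ;; pret bool r)
    (st F D p q s t i' j' x m c) Q.
  by move=> *; rewrite er; w_seq; w_assign; w_seq; w_assign; apply: wp_ret.
elim: bs bs' i j h h' iN jN er => [|b bs IH] [|b' bs'] i j h h' iN jN er q0;
  apply: wp_loop; w_seq; w_assign; w_seq; w_assign; rewrite !addn1; w_seq; w_read;
  w_seq; w_read; apply: wp_ret; rewrite /= in h h' er.
- by rewrite (negbTE h) h'; move: q0; rewrite er; apply.
- by case: h' => -> _; rewrite (negbTE h); move: q0; rewrite er; apply.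
- case: h => hi _; rewrite hi /=; case: eqP => [e|_]; last by move: q0; rewrite er; apply.
  by rewrite -e in h'.
case: h h' => hi h [hj h']; rewrite hi hj /=.
have ? : i.+1 < N by apply: bit_lt; rewrite hi.
have ? : j.+1 < N by apply: bit_lt; rewrite hj.
have e : (Some (inl (LBit A tau b)) == Some (inl (LBit A tau b')) :> sym) = (b == b').
  by apply/eqP/eqP => [[]|->].
rewrite e {e}; case: (eqVneq b b') er => [->|nb] er; last by move: q0; rewrite er eqseq_cons (negbTE nb); apply.
by apply: (IH bs') => //; [lia|lia|rewrite er eqseq_cons eqxx].
Qed.

(* [env] lists the variables and the positions of the open quantifiers below
   position [k], the innermost first. *)
Fixpoint env_at F k (env : seq (nat * nat)) : Prop :=
  if k is k'.+1 then
    if is_quant (F k') then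
      if env is (x, q) :: env' then [/\ q = k', bits_at k'.+2 (bits x) & env_at F k' env']
      else False
    else env_at F k' env
  else env = [::].

Lemma chase_run F D p q s t x m c env (Q : unit -> tstate lett work_letter -> Prop) :
  env_at F s env -> s <= N -> t < N ->
  Q tt (st F D p q 0 (chase digit L D t (unzip2 env)) 0 0 x m c) ->
  wp (find_loop true) (st F D p q s t 0 0 x m c) Q.
Proof.
elim: s t env => [|s IH] t env /= he sN tN q0; apply: wp_loop; w_seq; w_test.
  by apply: wp_ret; rewrite he in q0.
w_seq; w_assign; rewrite subn1 /=; w_seq; w_read.
case: (is_quant (F s)) he => [|he]; last by apply: wp_ret; apply: IH he _ _ q0; lia.
case: env q0 => // -[y r] env /= q0 [er _ he]; rewrite er in q0.
w_seq; w_read; rewrite -/(same_bit digit L D t s).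
case: (same_bit digit L D t s) q0 => q0; last by apply: wp_ret; apply: IH he _ _ q0; lia.
by w_seq; w_assign; apply: wp_ret; apply: IH he _ _ q0; lia.
Qed.

Lemma bits_inj : injective bits.
Proof.
have pos_inj : injective positive_bits.
  elim=> [p IH|p IH|] [p'|p'|] //= [] e; try by rewrite (IH _ e).
  - by case: p {IH} e.
  - by case: p' e.
move=> x y e; rewrite -(bin_of_natK x) -(bin_of_natK y); congr nat_of_bin.
have nb p : positive_bits p <> [::] by case: p.
move: e; rewrite /bits; case: (bin_of_nat x) (bin_of_nat y) => [|p] [|p'] //.
- by move/esym/nb.
- by move/nb.
- by move/pos_inj->.
Qed.

Lemma find_run F D p q s x m c y env (Q : unit -> tstate lett work_letter -> Prop) :
  env_at F s env -> bits_at p.+1 (bits y) -> s <= N -> p < N ->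
  Q tt (st F D p q 0 (element digit L D env y) 0 0 x m c) ->
  wp (find_loop false) (st F D p q s 0 0 0 x m c) Q.
Proof.
elim: s env => [|s IH] env /= he hb sN pN q0; apply: wp_loop; w_seq; w_test.
  by apply: wp_ret; rewrite he in q0.
w_seq; w_assign; rewrite subn1 /=; w_seq; w_read.
case: (is_quant (F s)) he => [|he]; last by apply: wp_ret; apply: IH he hb _ _ q0; lia.
case: env q0 => // -[z r] env /= q0 [er hz he]; rewrite er in q0.
w_seq; w_assign; rewrite addn1; w_seq; w_assign.
w_seq; apply: (same_var_run hz hb); try lia.
rewrite (inj_eq bits_inj) eq_sym; case: (y == z) q0 => q0.
  by w_seq; w_assign; apply: wp_ret; apply: chase_run he _ _ q0; lia.
by apply: wp_ret; apply: IH he hb _ _ q0; lia.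
Qed.

Lemma env_at_lt F k env : env_at F k env -> path gtn k (unzip2 env).
Proof.
elim: k env => [|k IH] env /=; first by move->.
case: is_quant => [|/IH]; last by case: (unzip2 env) => //= a b; lia.
by case: env => // -[y r] env [-> _ /IH /=]; rewrite ltnSn.
Qed.

Lemma element_lt F D k env y : env_at F k env -> k <= N -> element digit L D env y < N.
Proof.
move=> /env_at_lt /decreasing_lt h kN.
case: (boolP (y \in unzip1 env)) => [|yn].
  by move/(element_roots digit L D)/roots_sub/h; lia.
elim: env yn {h} => //= -[z r] env IH /=; rewrite inE negb_or => /andP[/negbTE -> /IH].
by [].
Qed.

Lemma env_at_blank F k k' env : (forall i, k <= i -> F i = None) -> k <= k' ->
  env_at F k env -> env_at F k' env.
Proof.
move=> hF; elim: k' => [|k' IH] kk' he; first by move: kk' he; rewrite leqn0 => /eqP ->.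
case: (ltngtP k k'.+1) kk' => // [kk _|e _]; last by rewrite -e.
by rewrite /= hF //=; apply: IH.
Qed.

Lemma eq_env_at F F' k env : (forall i, i < k -> is_quant (F i) = is_quant (F' i)) ->
  env_at F k env -> env_at F' k env.
Proof.
elim: k env => //= k IH env h; rewrite -h //.
have {}IH := IH _ (fun i ik => h i (ltnW ik)).
by case: is_quant; [case: env => // -[x q] env [-> ? /IH]|move/IH].
Qed.

(** [ys] are the points of the arguments already read; the bound on the exponent keeps their running
    index within a block. *)
Lemma eval_args_run F D p0 p q c env ys xs (Q : unit -> tstate lett work_letter -> Prop) :
  env_at F p0 env -> (forall i, p0 <= i -> F i = None) -> p0 <= p <= N ->
  word_at p (flatten [seq encode_var A tau x | x <- xs]) ->
  ~~ is_bit (W (p + size (flatten [seq encode_var A tau x | x <- xs]))) ->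
  N ^ (size ys + size xs) <= L -> {in ys, forall i, i < N} ->
  (let es := ys ++ [seq element digit L D env x | x <- xs] in
   Q tt (st F D (p + size (flatten [seq encode_var A tau x | x <- xs])) q 0 0 0 0
          (flat_index N es) (top es) c)) ->
  wp (eval_args (size xs)) (st F D p q 0 0 0 0 (flat_index N ys) (top ys) c) Q.
Proof.
elim: xs p ys => [|x xs IH] p ys /= he hF pN hw nb hL hy q0.
  by apply: wp_ret; rewrite addn0 cats0 in q0.
move: hw => [hp /word_at_cat [hx hw]]; rewrite size_map in hw.
have pN' : p < N by case: (ltnP p N) => // /W_end; rewrite hp.
have hb : bits_at p.+1 (bits x).
  apply: word_bits_at => //; case: xs hw nb {IH hL q0} => /= [_|y xs [-> _] //].
  by rewrite cats0 size_map addnS addSn.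
have hlt := element_lt D x he (leq_trans (proj1 (andP pN)) (proj2 (andP pN))).
set e := element digit L D env x in hlt q0.
have flt : flat_index N ys * N + N <= L.
  apply: leq_trans hL; rewrite addnS expnS -mulSnr mulnC leq_mul2l.
  apply/orP; right; apply: leq_trans (flat_lt hy) _.
  by rewrite leq_pexp2l // leq_addr.
have flt' : flat_index N ys <= L by nia.
have tlt : top ys < N by apply: top_lt.
have he' := env_at_blank hF (proj1 (andP pN)) he.
w_seq; w_seq; w_assign; apply: (find_run he' hb) => //; first lia.
w_seq; w_assign; w_seq; w_assign; w_seq; w_assign; w_seq; w_assign; rewrite addn1.
w_seq; apply: (skip_bits_run hb) => //.
rewrite -(flat_rcons N) -[_ + (_ - _)]/(foldl (fun a i => i + (a - i)) (top ys) [:: e]).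
rewrite -foldl_cat cats1 -/(top _).
apply: IH => //.
- by have := bits_at_le pN' hb; lia.
- by move: nb; rewrite size_cat size_map addnS addnA.
- by rewrite size_rcons addSnnS.
- by move=> i; rewrite mem_rcons inE => /orP[/eqP ->|/hy].
by rewrite /= cat_rcons; move: q0; rewrite size_cat size_map addnS !addSn addnA.
Qed.

Lemma eval_atom_run F D p q c env r (xs : (rel_arity r).-tuple nat)
    (Q : A -> tstate lett work_letter -> Prop) :
  env_at F p env -> (forall i, p <= i -> F i = None) ->
  word_at p (encode (Atom A xs)) -> ~~ is_bit (W (p + size (encode (Atom A xs)))) ->
  Q (lookup digit N L D r [seq element digit L D env x | x <- xs])
    (st F D (p + size (encode (Atom A xs))) q 0 0 0 0 0 0 c) ->
  wp (eval_atom r) (st F D p q 0 0 0 0 0 0 c) Q.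
Proof.
move=> he hF /= [hp hw] nb q0.
have pN : p < N by case: (ltnP p N) => // /W_end; rewrite hp.
w_seq; w_assign; rewrite addn1; w_seq; rewrite -{1}(size_tuple xs).
apply: (@eval_args_run F D p p.+1 q c env [::] xs) => //; first lia.
  by rewrite addSnnS.
  by rewrite (size_tuple xs); apply: arity_le.
rewrite cat0s /=; set es := map (element _ _ _ _) _; have hes : {in es, forall i, i < N}.
  by move=> i /mapP[x _ ->]; apply: element_lt he _; lia.
have tlt : top es < N by apply: top_lt.
have flt : flat_index N es < L.
  by apply: leq_trans (flat_lt hes) _; rewrite size_map size_tuple; apply: arity_le.
w_seq; w_read; w_seq; w_assign; w_seq; w_assign; apply: wp_ret.
by rewrite addSnnS.
Qed.

Lemma find_frame_run F D p q c p0 f (Q : sym -> tstate lett work_letter -> Prop) :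
  F p0 = f -> f != None -> (forall i, p0 < i < p -> F i = None) -> p0 < p -> p <= N ->
  Q f (st F D p p0 0 0 0 0 0 0 c) ->
  wp find_frame (st F D p q 0 0 0 0 0 0 c) Q.
Proof.
move=> hf fn hF pp pN q0; w_seq; w_assign.
suff: forall k, p0 < k <= p -> wp (frame_loop tt) (st F D p k 0 0 0 0 0 0 c) Q by apply; lia.
elim=> // k IH kp; apply: wp_loop; w_seq; w_test; w_seq; w_assign; rewrite subn1 /=.
w_seq; w_read; apply: wp_ret; case: (eqVneq p0 k) => [e|pk].
  by rewrite -e hf (negbTE fn).
by rewrite hF; [apply: IH|]; lia.
Qed.

Lemma find_no_frame_run F D p q c (Q : sym -> tstate lett work_letter -> Prop) :
  (forall i, i < p -> F i = None) -> p <= N ->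
  Q None (st F D p 0 0 0 0 0 0 0 c) ->
  wp find_frame (st F D p q 0 0 0 0 0 0 c) Q.
Proof.
move=> hF pN q0; w_seq; w_assign.
suff: forall k, k <= p -> wp (frame_loop tt) (st F D p k 0 0 0 0 0 0 c) Q by apply.
elim=> [|k IH] kp; apply: wp_loop; w_seq; w_test; first exact: wp_ret.
w_seq; w_assign; rewrite subn1 /=; w_seq; w_read; apply: wp_ret.
by rewrite hF //; apply: IH; lia.
Qed.

Lemma set_block_upd D p (f : {ffun 'I_L -> sym}) (i : 'I_L) y :
  upd (set_block D p f) (p * L + i) y = set_block D p [ffun j => if j == i then y else f j].
Proof.
apply: funext => k; rewrite /upd /set_block; case: leqP => h; last first.
  by case: eqP => // e; rewrite e in h; lia.
case: insubP => /= [j jL ej|nj].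
  by rewrite ffunE -val_eqE /= ej -(eqn_add2l (p * L) (k - _)) subnKC.
by case: eqP nj => // ->; rewrite addKn ltn_ord.
Qed.

Definition no_choice : {ffun 'I_L -> sym} := [ffun=> None].

Lemma set_block_blank D p : (forall k, p * L <= k -> D k = None) ->
  set_block D p no_choice = D.
Proof.
move=> hD; apply: funext => k; rewrite /set_block; case: leqP => // h.
by case: insubP => //= i _ _; rewrite ffunE hD.
Qed.

Lemma next_choice_run F D P p (f : {ffun 'I_L -> sym}) (Q : bool -> tstate lett work_letter -> Prop) :
  p < N ->
  (forall g : {ffun 'I_L -> sym}, numeral None g = (numeral None f).+1 ->
     Q true (st F (set_block D p g) P p 0 0 0 0 0 0 0)) ->
  ((forall g : {ffun 'I_L -> sym}, numeral None g <= numeral None f) ->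
     Q false (st F (set_block D p no_choice) P p 0 0 0 0 0 0 0)) ->
  wp next_choice (st F (set_block D p f) P p 0 0 0 0 0 0 0) Q.
Proof.
move=> pN q1 q2; w_seq.
(* The block after the carry has passed [k] digits. *)
pose fk k : {ffun 'I_L -> sym} := [ffun i : 'I_L => if i < k then None else f i].
suff: forall d k, d + k = L -> (forall i : 'I_L, i < k -> next None (f i) = None) ->
    wp (choice_loop tt) (st F (set_block D p (fk k)) P p 0 0 0 0 0 0 k)
      (fun b S => wp (assign 13 (Cst 0) ;; pret bool b) S Q).
  move=> /(_ L 0 (addn0 L)); have -> : fk 0 = f by apply/ffunP => i; rewrite ffunE.
  by apply.
elim=> [|d IH] k dk last; apply: wp_loop; w_seq; w_test.
  have -> : (L - k == 0) = true by lia.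
  apply: wp_ret; w_seq; w_assign; apply: wp_ret.
  have -> : fk k = no_choice by apply/ffunP => i; rewrite !ffunE ifT //; have := ltn_ord i; lia.
  by apply: q2 => g; apply: numeral_max => i; apply: last; have := ltn_ord i; lia.
have kL : k < L by lia.
have -> : (L - k == 0) = false by lia.
w_seq; w_read; rewrite (set_block_in D p (fk k) (Ordinal kL)) ffunE ltnn.
case e: (next None (f (Ordinal kL))) => [y|].
  w_seq; w_store; rewrite (set_block_upd D p (fk k) (Ordinal kL)); apply: wp_ret.
  w_seq; w_assign; apply: wp_ret; apply: q1; apply: (numeral_next (c := Ordinal kL)).
  - move=> i /= ik; split; first exact: last.
    by rewrite !ffunE -val_eqE /= ik; case: eqP => // e'; rewrite e' ltnn in ik.
  - by rewrite e ffunE eqxx.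
  - move=> i /= ki; rewrite !ffunE -val_eqE /= (leq_gtF (ltnW ki)).
    by case: eqP => // e'; rewrite e' ltnn in ki.
w_seq; w_store; rewrite (set_block_upd D p (fk k) (Ordinal kL)).
have -> : [ffun j => if j == Ordinal kL then None else fk k j] = fk k.+1.
  by apply/ffunP => i; rewrite !ffunE -val_eqE /= ltnS; case: ltngtP.
w_seq; w_assign; rewrite addn1; apply: wp_ret; apply: IH; first lia.
move=> i; rewrite ltnS leq_eqVlt => /orP[/eqP ei|/last //].
by rewrite -[RHS]e; congr (next None (f _)); apply: val_inj.
Qed.

Notation st0 F D p := (st F D p 0 0 0 0 0 0 0 0).
Notation value_at phi p env D := (sure_value digit N L phi p env D).

Lemma main_enter S (Q : A -> tstate lett work_letter -> Prop) :
  wp enter S (fun m S' => wp (main_loop m) S' Q) -> wp (main_loop None) S Q.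
Proof.
move=> h; apply: wp_loop; w_seq; apply: (wp_conseq h) => m S' h'; exact: wp_ret.
Qed.

Lemma main_return a S (Q : A -> tstate lett work_letter -> Prop) :
  wp (return_value a) S (fun r S' => match r with
    | inl m => wp (main_loop m) S' Q | inr b => Q b S' end) ->
  wp (main_loop (Some a)) S Q.
Proof. by move=> h; apply: wp_loop. Qed.

(** In continuation form: entering [phi] may be replaced by returning its value just past its word,
    with both arrays restored. A bit following the word would prolong its last numeral, hence the
    second condition. *)
Definition evaluates phi := forall p F D env, word_at p (encode phi) ->
  ~~ is_bit (W (p + size (encode phi))) ->
  (forall i, p <= i -> F i = None) -> (forall k, p * L <= k -> D k = None) ->
  env_at F p env -> forall Q : A -> tstate lett work_letter -> Prop,
  wp (main_loop (Some (value_at phi p env D))) (st0 F D (p + size (encode phi))) Q ->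
  wp (main_loop None) (st0 F D p) Q.

Lemma upd_upd (T : Type) (f : nat -> T) i x y : upd (upd f i x) i y = upd f i y.
Proof. by apply: funext => j; rewrite /upd; case: eqP. Qed.

Lemma upd_same (T : Type) (f : nat -> T) i x : f i = x -> upd f i x = f.
Proof. by move=> <-; apply: upd_id. Qed.

Lemma word_at_lt p l w : word_at p (l :: w) -> p < N.
Proof. by case=> h _; case: (ltnP p N) => // /W_end; rewrite h. Qed.

(** Hence numerals need no end marker in front of a formula. *)
Lemma encode_not_bit p (phi : formula A tau) w : word_at p (encode phi ++ w) -> ~~ is_bit (W p).
Proof. by case: phi => [r xs|f g|f g|o a|x f|x f] /= [-> _]. Qed.

Section Frame.
Variables (p : nat) (F : nat -> sym) (D : nat -> sym) (env : seq (nat * nat)) (l : lett).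
Hypothesis Wp : W p = Some (inl l).
Hypothesis F_blank : forall i, p <= i -> F i = None.
Hypothesis D_blank : forall k, p * L <= k -> D k = None.
Hypothesis env_p : env_at F p env.

Lemma p_lt_N : p < N.
Proof. by case: (ltnP p N) => // /W_end; rewrite Wp. Qed.

Lemma upd_blank x i : p < i -> upd F p x i = None.
Proof. by move=> pi; rewrite /upd; case: eqP => [e|_]; [lia|apply: F_blank; lia]. Qed.

Lemma env_below x : env_at (upd F p x) p env.
Proof. by apply: eq_env_at env_p => i ip; rewrite /upd; case: eqP => // e; lia. Qed.

Lemma env_op s p' : p < p' -> env_at (upd F p (op_frame s)) p' env.
Proof.
move=> pp; apply: (@env_at_blank _ p.+1) => //; first by move=> i; apply: upd_blank.
by rewrite /= {1}/upd eqxx; apply: env_below.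
Qed.

Lemma env_quant a x p' : p < p' -> bits_at p.+2 (bits x) ->
  env_at (upd F p (quant_frame a)) p' ((x, p) :: env).
Proof.
move=> pp hb; apply: (@env_at_blank _ p.+1) => //; first by move=> i; apply: upd_blank.
by rewrite /= {1}/upd eqxx; split=> //; apply: env_below.
Qed.

Fixpoint values_at (fs : seq (formula A tau)) p' : seq A :=
  if fs is f :: fs' then value_at f p' env D :: values_at fs' (p' + size (encode f)) else [::].

Lemma arity_max : arity l <= max_args.
Proof.
rewrite /max_args; case: (l) => //= [u| |]; rewrite leq_max ?leqnn //.
by rewrite (leq_bigmax u) orbT.
Qed.

(** [vs] are the values already returned, recorded in the frame alone; [arity_max] ensures that they
    fit into it. *)
Lemma args_run fs vs p' (Q : A -> tstate lett work_letter -> Prop) :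
  p < p' <= N -> fs <> [::] -> size vs + size fs = arity l ->
  (forall f, List.In f fs -> evaluates f) ->
  word_at p' (flatten [seq encode f | f <- fs]) ->
  ~~ is_bit (W (p' + size (flatten [seq encode f | f <- fs]))) ->
  wp (main_loop (Some (apply_op l (vs ++ values_at fs p'))))
    (st0 F D (p' + size (flatten [seq encode f | f <- fs]))) Q ->
  wp (main_loop None) (st0 (upd F p (op_frame (insub_bseq _ vs))) D p') Q.
Proof.
elim: fs vs p' => // f fs IH vs p' pp _ sz hev /word_at_cat [hw hws] nb q.
have hle : p' + size (encode f) <= N by apply: word_at_le hw; lia.
have hnext : ~~ is_bit (W (p' + size (encode f))).
  case: fs hws nb {IH sz hev q} => [|f' fs] /=; last by move=> h _; apply: encode_not_bit h.
  by rewrite cats0.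
have size_f : 0 < size (encode f) by case: (f).
apply: (hev f (or_introl erefl)) hw hnext _ _ (env_op _ _) _ _; try lia.
- by move=> i ip; apply: upd_blank; lia.
- by move=> k pk; apply: D_blank; nia.
apply: main_return; w_seq; apply: (@find_frame_run _ _ _ _ _ p (op_frame (insub_bseq _ vs))).
- by rewrite /upd eqxx.
- by [].
- by move=> i /andP[pi _]; apply: upd_blank.
- by lia.
- by [].
have pN := p_lt_N.
w_seq; w_read; rewrite Wp /op_frame.
have -> : insub_bseq max_args vs = vs :> seq A.
  by rewrite /insub_bseq val_insubd; case: ifP => //; have := arity_max; move: sz => /=; lia.
rewrite /return_op size_rcons; case: eqP => e.
  have efs : fs = [::] by case: (fs) sz => //= *; lia.
  w_seq; w_store; w_seq; w_assign; apply: wp_ret.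
  rewrite upd_upd upd_same ?F_blank //.
  by move: q; rewrite efs /= cats0 cats1.
w_seq; w_store; w_seq; w_assign; apply: wp_ret; rewrite upd_upd.
apply: IH => //.
- by lia.
- by move=> e'; case: e; rewrite -sz e' /= addn1.
- by rewrite size_rcons addSnnS.
- by move=> g hg; apply: hev; right.
- by move: nb; rewrite size_cat addnA.
- by move: q; rewrite size_cat addnA cat_rcons.
Qed.

Section Quantifier.
Variables (x : nat) (phi : formula A tau) (idx : A) (op : Monoid.com_law idx).
Let p' := p.+2 + size (bits x).
Hypothesis op_l : quant_op l = op.
Hypothesis bits_x : bits_at p.+2 (bits x).
Hypothesis ev : evaluates phi.
Hypothesis word_phi : word_at p' (encode phi).
Hypothesis end_phi : ~~ is_bit (W (p' + size (encode phi))).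

Let V (g : {ffun 'I_L -> sym}) := value_at phi p' ((x, p) :: env) (set_block D p g).

(** [acc] covers the strings before [g]; those from [g] on are still to be combined. An abstract
    [op] treats infimum and supremum together. *)
Lemma quant_run (g : {ffun 'I_L -> sym}) acc (Q : A -> tstate lett work_letter -> Prop) :
  wp (main_loop (Some (op acc
      (\big[op/idx]_(h : {ffun 'I_L -> sym} | numeral None g <= numeral None h) V h))))
    (st0 F D (p' + size (encode phi))) Q ->
  wp (main_loop None) (st0 (upd F p (quant_frame acc)) (set_block D p g) p') Q.
Proof.
have pN := p_lt_N.
have size_phi : 0 < size (encode phi) by case: (phi).
have pN' : p' < N by case: (encode phi) size_phi word_phi => // a w _ /word_at_lt.
have hle : p' + size (encode phi) <= N by apply: word_at_le word_phi; lia.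
have pp' : p < p' by rewrite /p'; lia.
pose M := \max_(h : {ffun 'I_L -> sym}) numeral None h.
have hM (h : {ffun 'I_L -> sym}) : numeral None h <= M by exact: (leq_bigmax h).
have [k] := ubnP (M - numeral None g); elim: k g acc => // k IH g acc hk q.
apply: (ev word_phi end_phi _ _ (env_quant acc pp' bits_x)).
- by move=> i ip; apply: upd_blank; lia.
(* The block of [g] ends at [p.+1 * L], so the blocks of inner quantifiers are still blank. *)
- move=> i pi; have pi' : p.+1 * L <= i by nia.
  rewrite /set_block ifT; last by nia.
  case: insubP => [j jL _|_] /=; first by lia.
  by apply: D_blank; nia.
apply: main_return; w_seq; apply: (@find_frame_run _ _ _ _ _ p (quant_frame acc)).
- by rewrite /upd eqxx.
- by [].
- by move=> i /andP[pi _]; apply: upd_blank.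
- by lia.
- by [].
w_seq; w_read; rewrite Wp /quant_frame /= op_l; w_seq.
apply: next_choice_run => // [g' eg'|last].
  w_seq; w_store; w_seq; w_assign; rewrite addn2; w_seq.
  apply: (skip_bits_run bits_x); first by rewrite /p' in pN'; lia.
  w_seq; w_assign; apply: wp_ret; rewrite upd_upd; apply: IH; first by have := hM g'; lia.
  (* By injectivity of [numeral], the strings from [g] on are [g] and those from its successor [g']
     on. *)
  rewrite (bigD1 g) //= Monoid.mulmA in q.
  congr (wp (main_loop (Some (op _ _))) _ _): q; apply: eq_bigl => h.
  rewrite eg' ltn_neqAle andbC; congr (_ && _).
  by rewrite (inj_eq (@numeral_ffun_inj _ _ _)) eq_sym.
w_seq; w_store; w_seq; w_assign; apply: wp_ret.
rewrite upd_upd upd_same ?F_blank // set_block_blank //.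
rewrite (big_pred1 g) // in q => h /=.
by rewrite -(inj_eq (@numeral_ffun_inj _ None _)) eqn_leq last.
Qed.

Lemma enter_quant_run (Q : A -> tstate lett work_letter -> Prop) : quant_start l = idx ->
  wp (main_loop (Some (\big[op/idx]_(h : {ffun 'I_L -> sym}) V h)))
    (st0 F D (p' + size (encode phi))) Q ->
  wp (enter_quant l) (st0 F D p) (fun m S' => wp (main_loop m) S' Q).
Proof.
move=> hs q; have pN := p_lt_N.
have pN' : p.+1 < N.
  have : p' < N.
    have : 0 < size (encode phi) by case: (phi).
    by case: (encode phi) word_phi => // a w /word_at_lt.
  by rewrite /p'; lia.
w_seq; w_store; w_seq; w_assign; w_seq; rewrite addn2.
apply: (skip_bits_run bits_x) => //; apply: wp_ret.
(* The untouched block is the string of numeral 0, so all strings are still to come. *)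
rewrite -(set_block_blank D_blank); apply: quant_run.
rewrite hs Monoid.mul1m; congr (wp (main_loop (Some _)) _ _): q.
apply: eq_bigl => h; rewrite /numeral big1 // => i _.
by rewrite ffunE rank0.
Qed.

End Quantifier.

Lemma enter_op_run fs (Q : A -> tstate lett work_letter -> Prop) :
  size fs = arity l ->
  (forall f, List.In f fs -> evaluates f) ->
  word_at p.+1 (flatten [seq encode f | f <- fs]) ->
  ~~ is_bit (W (p.+1 + size (flatten [seq encode f | f <- fs]))) ->
  wp (main_loop (Some (apply_op l (values_at fs p.+1))))
    (st0 F D (p.+1 + size (flatten [seq encode f | f <- fs]))) Q ->
  wp (enter_op l) (st0 F D p) (fun m S' => wp (main_loop m) S' Q).
Proof.
move=> sz hev hw nb q; have pN := p_lt_N; rewrite /enter_op -sz.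
case: eqP => [e|e].
  move: q; rewrite (size0nil e) /= addn0 => q.
  by w_seq; w_assign; apply: wp_ret; rewrite addn1.
w_seq; w_store; w_seq; w_assign; apply: wp_ret; rewrite addn1.
apply: (@args_run fs [::]) => //; first by lia.
by move=> e'; rewrite e' in e.
Qed.

Lemma nth_values_at fs p' f0 i : i < size fs ->
  nth \bot%O (values_at fs p') i =
  value_at (nth f0 fs i) (p' + args_offset (@encode _ A tau) fs i) env D.
Proof.
rewrite /args_offset; elim: fs p' i => // f fs IH p' [|i] /= h; first by rewrite addn0.
by rewrite IH // size_cat addnA.
Qed.

End Frame.

Theorem evaluates_formula phi : evaluates phi.
Proof.
elim: phi => [r xs|phi IH1 psi IH2|phi IH1 psi IH2|o args IH|x phi IH|x phi IH]
  p F D env hw nb hF hD he Q q; apply: main_enter; w_seq; have pN := word_at_lt hw;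
  have Wp := proj1 hw; w_read; rewrite Wp.
- w_seq; apply: (@eval_atom_run _ _ _ _ _ _ _ xs _ he) => //.
  by apply: wp_ret.
- apply: (@enter_op_run _ _ _ _ _ Wp hF hD he [:: phi; psi]) => //=.
  + by move=> f [<-|[<-|]].
  + by rewrite cats0; case: hw.
  + by rewrite cats0 addSnnS.
  + by move: q; rewrite /= cats0 addnS.
- apply: (@enter_op_run _ _ _ _ _ Wp hF hD he [:: phi; psi]) => //=.
  + by move=> f [<-|[<-|]].
  + by rewrite cats0; case: hw.
  + by rewrite cats0 addSnnS.
  + by move: q; rewrite /= cats0 addnS.
- have em : [seq encode f | f <- [seq args i | i <- enum 'I_(oper_arity o)]] =
            [seq encode (args i) | i <- enum 'I_(oper_arity o)] by rewrite -map_comp.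
  apply: (@enter_op_run _ _ _ _ _ Wp hF hD he [seq args i | i <- enum 'I_(oper_arity o)]).
  + by rewrite size_map size_enum_ord.
  + by move=> f /List.in_map_iff [i [<- _]].
  + by rewrite em; case: hw.
  + by rewrite em addSnnS.
  move: q; rewrite em /= addnS => q; congr (wp (main_loop (Some _)) _ _): q.
  congr oper_fun; apply: eq_from_tnth => i; rewrite !tnth_mktuple.
  have si : i < size (enum 'I_(oper_arity o)) by rewrite size_enum_ord.
  rewrite (nth_values_at _ _ _ (args i)); last by rewrite size_map.
  by rewrite (nth_map i _ _ si) nth_ord_enum /args_offset em.
- move: hw nb q => /= [_ [_ /word_at_cat [hx hphi]]]; rewrite size_cat !size_map => nb q.
  have hb : bits_at p.+2 (bits x).
    apply: word_bits_at => //; rewrite -(cats0 (encode phi)) in hphi.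
    by move: (encode_not_bit hphi); rewrite size_map.
  rewrite !addnS addnA -!addSn in nb q; rewrite size_map in hphi.
  apply: (@enter_quant_run _ _ _ _ _ Wp hF hD he x phi _ (@Order.meet disp A)) => //.
- move: hw nb q => /= [_ [_ /word_at_cat [hx hphi]]]; rewrite size_cat !size_map => nb q.
  have hb : bits_at p.+2 (bits x).
    apply: word_bits_at => //; rewrite -(cats0 (encode phi)) in hphi.
    by move: (encode_not_bit hphi); rewrite size_map.
  rewrite !addnS addnA -!addSn in nb q; rewrite size_map in hphi.
  apply: (@enter_quant_run _ _ _ _ _ Wp hF hD he x phi _ (@Order.join disp A)) => //.
Qed.
End Run.

(** * Initialization of the tapes *)

Section Initialization.
Variables (w : seq lett) (m B : nat).
Let N := size w.
Let W := nth (None : sym) [seq Some (inl l) | l <- w].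
Let blank : nat -> sym := fun=> None.
Hypothesis N_gt0 : 0 < N.
Hypothesis B_ge : (N + 2) * (N ^ m + 2) <= B.

Notation setup n l := (ram mark W blank blank (0 :: 0 :: 0 :: n :: l :: nseq 9 0)).

(** The machine has no tapes above index 20; they count as marked because [ram] has registers at all
    indices from 3 on. *)
Definition initial_state : tstate lett work_letter :=
  TState (fun i => if i < 3 then with_arrays mark W blank blank i else
                   if i <= 20 then blank else register_cells lett mark) (fun=> 0).

Lemma mark_registers_run (Q : unit -> tstate lett work_letter -> Prop) :
  Q tt (setup 0 0) -> wp B (mark_registers 18 3) initial_state Q.
Proof.
pose c k i : nat -> sym := if i < 3 then with_arrays mark W blank blank i else
  if (i < k) || (20 < i) then register_cells lett mark else blank.
have -> : initial_state = TState (c 3) (fun=> 0).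
  congr TState; apply: funext => i; rewrite /c; case: ltnP => //.
  by rewrite ltnNge; case: leqP.
have -> : setup 0 0 = TState (c 21) (fun=> 0).
  congr TState; apply: funext => i; last first.
    by rewrite -[_ :: _]/(nseq 14 0) nth_nseq if_same.
  by rewrite /c; case: i => [|[|[|i]]] //=; rewrite ifT //; lia.
suff: forall k i, k + i = 21 -> 2 < i -> Q tt (TState (c 21) (fun=> 0)) ->
    wp B (mark_registers k i) (TState (c i) (fun=> 0)) Q by apply.
elim=> [|k IH] i ki i3 q /=; first by apply: wp_ret; rewrite -ki in q.
apply: wp_bind; apply: wp_write; first by lia.
have -> : upd (c i) i (upd (c i i) 0 (Some (inr mark))) = c i.+1.
  apply: funext => j; rewrite /upd; case: (eqVneq j i) => [->|ji].
    have -> : c i i = blank by rewrite /c ltnn; rewrite !ifF //; lia.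
    have -> : c i.+1 i = register_cells lett mark by rewrite /c ltnSn ifF //; lia.
    by apply: funext => n.
  by rewrite /c (_ : (j < i.+1) = (j < i)) //; lia.
by apply: IH => //; lia.
Qed.

Lemma set_power_run l k (Q : unit -> tstate lett work_letter -> Prop) :
  l * N ^ k = N ^ m -> Q tt (setup N (N ^ m)) -> wp B (set_power k) (setup N l) Q.
Proof.
elim: k l => [|k IH] l lk q /=.
  by apply: wp_ret; rewrite -lk expn0 muln1 in q.
apply: wp_bind; apply: wp_assign; [by []|by []|by []|by []|by []|rewrite /=|rewrite /=].
  have : l <= N ^ m by rewrite -lk leq_pmulr // expn_gt0 N_gt0.
  by nia.
by apply: IH => //; rewrite -mulnA -expnS.
Qed.

Lemma W_some i : i < N -> W i != None.
Proof.
move=> iN; have l0 : lett by move: N_gt0; rewrite /N; case: (w).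
by rewrite /W (nth_map l0).
Qed.

Lemma W_none i : N <= i -> W i = None.
Proof. by move=> Ni; rewrite /W nth_default // size_map. Qed.

Lemma word_at_W : word_at W 0 w.
Proof.
have h w1 w2 : w = w1 ++ w2 -> word_at W (size w1) w2.
  elim: w2 w1 => //= l w2 IH w1 e; split; last first.
    by have := IH (rcons w1 l); rewrite size_rcons cat_rcons; apply.
  by rewrite /W e map_cat nth_cat size_map ltnn subnn.
exact: (h [::]).
Qed.

Theorem evaluator_run phi : w = encode phi -> (forall r : tau, N ^ rel_arity r <= N ^ m) ->
  N <= N ^ m -> wp B (evaluator m) initial_state
    (fun a _ => a = sure_value digit N (N ^ m) phi 0 [::] blank).
Proof.
move=> ew har NL; apply: wp_bind; apply: mark_registers_run; apply: wp_bind.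
set Q := (X in wp B _ _ X).
suff: forall k n, n + k = N -> wp B (ploop (fun _ : unit => x <~ read 0 rN ;;
    if x == None then pret (unit + unit)%type (inr tt)
    else assign 3 (rN + Cst 1)%X ;; pret (unit + unit)%type (inl tt)) tt) (setup n 0) Q.
  by apply.
elim=> [|k IH] n nk; apply: wp_loop; apply: wp_bind;
  (apply: wp_read; [by []|by []|by []|by []|by []|by []|by rewrite /=; nia|rewrite /=]).
  rewrite W_none ?eqxx; last by lia.
  apply: wp_ret; rewrite addn0 in nk; rewrite nk /Q {Q}.
  apply: wp_bind; apply: wp_assign; [by []|by []|by []|by []|by []|by rewrite /=; nia|rewrite /=].
  apply: wp_bind; apply: set_power_run; first by rewrite mul1n.
  apply: (@evaluates_formula W N (N ^ m) B W_none N_gt0 NL har B_ge phi 0) => //.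
  - by rewrite -ew; apply: word_at_W.
  - by rewrite -ew W_none.
  (* All frames have been erased by now, so the returned value is the result. *)
  apply: main_return; apply: wp_bind; apply: (find_no_frame_run N_gt0 NL B_ge) => //.
    by rewrite -ew.
  apply: wp_bind; apply: wp_read; [by []|by []|by []|by []|by []|by []|by []|rewrite /=].
  exact: wp_ret.
rewrite (negbTE (W_some _)); last by lia.
apply: wp_bind; apply: wp_assign; [by []|by []|by []|by []|by []|by rewrite /=; nia|rewrite /=].
by apply: wp_ret; apply: IH; lia.
Qed.

End Initialization.

End Machine.

(** * Extension properties hold almost surely *)

Import Order.TTheory GRing.Theory Num.Theory.
Import numFieldNormedType.Exports.

Section Independence.
Local Open Scope ring_scope.
Variables (R : realFieldType) (I U X : finType) (w : I -> X -> R).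
Variables (C : U -> {set I}) (c : I -> X).
Hypothesis w1 : forall i, \sum_a w i a = 1.
Hypothesis disj : forall e e' i, i \in C e -> i \in C e' -> e = e'.

(** By disjointness at most one factor pins coordinate [i]; if there is none, the weights sum to
    1. *)
Lemma sum_pinned (S : {set U}) i :
  \sum_a (w i a * \prod_(e in S | i \in C e) (a == c i)%:R) =
  \prod_(e in S | i \in C e) w i (c i).
Proof.
case: (pickP [pred e in S | i \in C e]) => [e0 /= /andP[e0S ie0]|no]; last first.
  rewrite (eq_bigl xpred0 _ no) big_pred0_eq -[RHS](w1 i).
  by apply: eq_bigr => a _; rewrite (eq_bigl xpred0 _ no) big_pred0_eq mulr1.
have one e : (e \in S) && (i \in C e) = (e == e0).
  by apply/andP/eqP => [[_ ie]|->//]; exact: disj ie ie0.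
rewrite (eq_bigl _ _ one) big_pred1_eq (bigD1 (c i)) //=.
rewrite (eq_bigl _ _ one) big_pred1_eq eqxx mulr1 big1 ?addr0 // => a /negbTE ac.
by rewrite (eq_bigl _ _ one) big_pred1_eq ac mulr0.
Qed.

Lemma prod_1B (x : U -> R) :
  \prod_e (1 - x e) = \sum_(S : {set U}) (-1) ^+ #|S| * \prod_(e in S) x e.
Proof.
under eq_bigr do rewrite addrC; rewrite bigA_distr; apply: eq_bigr => S _.
by rewrite -big_mkcond /= prodrN.
Qed.

(* Independence for disjoint sets of coordinates: expand the product of the
   [1 - indicator] over the subsets of U. *)
Lemma sum_avoid :
  \sum_(f : {ffun I -> X} | [forall e, [exists i in C e, f i != c i]]) \prod_i w i (f i) =
  \prod_e (1 - \prod_(i in C e) w i (c i)).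
Proof.
have ind (f : {ffun I -> X}) : (if [forall e, [exists i in C e, f i != c i]]
    then \prod_i w i (f i) else 0) =
    \prod_i w i (f i) * \prod_e (1 - \prod_(i in C e) (f i == c i)%:R).
  case: forallP => [h|h].
    rewrite [X in _ * X]big1 ?mulr1 // => e _; have /exists_inP[i iC /negbTE ne] := h e.
    by rewrite (bigD1 i) //= ne mul0r subr0.
  move/existsNP: h => [e /negP]; rewrite negb_exists_in => /forall_inP h.
  rewrite [X in _ = _ * X](bigD1 e) //= [X in 1 - X]big1 ?subrr ?mul0r ?mulr0 // => i /h.
  by rewrite negbK => ->.
rewrite big_mkcond /=; under eq_bigr do rewrite ind prod_1B mulr_sumr.
rewrite exchange_big prod_1B; apply: eq_bigr => S _ /=.
under eq_bigr do rewrite mulrCA; rewrite -mulr_sumr; congr (_ * _).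
rewrite [RHS](exchange_big_dep predT) //=; under [RHS]eq_bigr do rewrite -sum_pinned.
rewrite bigA_distr_bigA /=; apply: eq_bigr => f _.
by rewrite big_split /= (exchange_big_dep predT).
Qed.

End Independence.

(** * Polynomial growth against geometric decay *)

Section Rate.
Local Open Scope ring_scope.
Variable R : realType.

Lemma bernoulli_ineq (t : R) m : 0 <= t <= 1 -> 1 - m%:R * t <= (1 - t) ^+ m.
Proof.
move=> /andP[t0 t1]; elim: m => [|m IH]; first by rewrite mul0r subr0.
have h : (1 - t) * (1 - m%:R * t) <= (1 - t) * (1 - t) ^+ m by rewrite ler_wpM2l // subr_ge0.
have m0 : 0 <= m%:R * (t * t) by rewrite !mulr_ge0.
by rewrite exprS -natr1; lra.
Qed.

Lemma muln_expr_le (z : R) n : 0 <= z <= 1 -> n%:R * z ^+ n * (1 - z) <= 1.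
Proof.
(* The sharper bound is inductive: its right side is [1 - z] times the sum of the [n] powers
   [z ^+ i], [i < n], each at least [z ^+ n]. *)
move=> /andP[z0 z1]; suff: n%:R * z ^+ n * (1 - z) <= 1 - z ^+ n.
  by have := exprn_ge0 n z0; lra.
elim: n => [|n IH]; first by rewrite !mul0r expr0 subrr.
have h0 := exprn_ge0 n z0; have h1 : z ^+ n <= 1 by apply: exprn_ile1.
have h2 : z * (n%:R * z ^+ n * (1 - z)) <= z * (1 - z ^+ n) by rewrite ler_wpM2l.
have h3 : 0 <= (1 - z) * (1 - z * z ^+ n).
  by rewrite mulr_ge0 ?subr_ge0 // mulr_ile1.
rewrite exprS -natr1; lra.
Qed.

(** For [z < 1] with [x <= z ^+ K.+1], [K] of the factors [z] absorb the polynomial by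
    [muln_expr_le], and the last one gives the decay. *)
Lemma poly_geometric_cvg0 (a x : R) K : 0 <= a -> 0 <= x < 1 ->
  (a * n.+1%:R ^+ K * x ^+ (n.+1 - K) @[n --> \oo] --> (0 : R))%classic.
Proof.
move=> a0 /andP[x0 x1]; have K0 : 0 < K.+1%:R :> R by [].
(* Chosen so that Bernoulli's inequality yields exactly [x <= z ^+ K.+1]. *)
pose z := 1 - (1 - x) / K.+1%:R.
have t01 : 0 <= (1 - x) / K.+1%:R <= 1.
  apply/andP; split; first by rewrite divr_ge0 // subr_ge0 ltW.
  rewrite ler_pdivrMr // mul1r.
  by apply: (@le_trans _ _ 1); [lra|rewrite ler1n].
have t0 : 0 < (1 - x) / K.+1%:R by rewrite divr_gt0 // subr_gt0.
have z01 : 0 <= z < 1 by rewrite /z subr_ge0 gtrBl t0 andbT; case/andP: t01.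
have [z0 z1] := andP z01.
have xz : x <= z ^+ K.+1.
  have := bernoulli_ineq K.+1 t01; rewrite mulrCA mulfV ?gt_eqF // mulr1 -/z => h; apply: le_trans h; lra.
(* The shift turns the truncated exponent into [n.+1]. *)
rewrite -(cvg_shiftn K).
pose b := a * K.+1%:R ^+ K * (1 - z)^-1 ^+ K * z.
have bound n : 0 <= a * (n + K)%N.+1%:R ^+ K * x ^+ ((n + K)%N.+1 - K) <= geometric b z n.
  have -> : ((n + K)%N.+1 - K = n.+1)%N by lia.
  apply/andP; split; first by rewrite !mulr_ge0 ?exprn_ge0.
  have h1 : (n + K)%N.+1%:R ^+ K <= (K.+1%:R * n.+1%:R) ^+ K :> R.
    by apply: lerXn2r; rewrite ?nnegrE ?mulr_ge0 // -natrM ler_nat; nia.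
  have h2 : x ^+ n.+1 <= (z ^+ n.+1) ^+ K * z ^+ n.+1.
    rewrite -exprSr -exprM mulnC exprM; apply: lerXn2r => //.
    by rewrite nnegrE exprn_ge0.
  have h3 : n.+1%:R * z ^+ n.+1 <= (1 - z)^-1.
    by rewrite -[X in _ <= X]mul1r ler_pdivlMr; [apply: muln_expr_le; rewrite z0 ltW|lra].
  have h4 : (n.+1%:R * z ^+ n.+1) ^+ K <= (1 - z)^-1 ^+ K.
    apply: lerXn2r; rewrite ?nnegrE ?invr_ge0 ?mulr_ge0 ?exprn_ge0 //; lra.
  rewrite /geometric /b /=.
  apply: (@le_trans _ _ (a * (K.+1%:R * n.+1%:R) ^+ K * ((z ^+ n.+1) ^+ K * z ^+ n.+1))).
    apply: ler_pM => //; rewrite ?mulr_ge0 ?exprn_ge0 //.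
    by apply: ler_wpM2l.
  have -> : a * (K.+1%:R * n.+1%:R) ^+ K * ((z ^+ n.+1) ^+ K * z ^+ n.+1) =
      a * K.+1%:R ^+ K * z ^+ n.+1 * (n.+1%:R * z ^+ n.+1) ^+ K.
    by rewrite !exprMn; ring.
  have -> : a * K.+1%:R ^+ K * (1 - z)^-1 ^+ K * z * z ^+ n =
      a * K.+1%:R ^+ K * z ^+ n.+1 * (1 - z)^-1 ^+ K by rewrite exprS; ring.
  by apply: ler_wpM2l => //; rewrite !mulr_ge0 ?exprn_ge0.
apply: (@squeeze_cvgr _ _ _ _ (cst 0) (geometric b z)).
- by apply: nearW => n; exact: bound.
- exact: cvg_cst.
- by apply: cvg_geometric; rewrite ger0_norm; lra.
Qed.

End Rate.

(** * Failure probability of the extension property *)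

Section AlmostSure.
Local Open Scope ring_scope.
Variables (R : realType) (disp : Order.disp_t) (A : latticeAlgebra disp) (tau : vocabulary).
Variables (p : tau -> A -> R) (K : nat).
Hypothesis p_pos : positive_distributions p.

Let p_gt0 r b : 0 < p r b. Proof. by have [] := p_pos r. Qed.

(** A positive lower bound of all weights: as they are at most 1, their product will do for the
    minimum, and it makes sense for empty [tau] as well. *)
Definition least_weight := \prod_r \prod_b p r b.

Lemma p_le1 r b : p r b <= 1.
Proof.
have [_ <-] := p_pos r; rewrite (bigD1 b) //= lerDl.
by apply: sumr_ge0 => a _; apply: ltW.
Qed.

Lemma least_weight_gt0 : 0 < least_weight.
Proof. by apply: prodr_gt0 => r _; apply: prodr_gt0. Qed.

Lemma least_weight_le r b : least_weight <= p r b.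
Proof.
rewrite /least_weight (bigD1 r) //= (bigD1 b) //= -mulrA.
apply: ler_piMr; first exact: ltW.
apply: mulr_ile1.
- by apply: prodr_ge0 => a _; apply: ltW.
- by apply: prodr_ge0 => s _; apply: prodr_ge0 => a _; apply: ltW.
- by apply: prodr_ile1 => a _; rewrite ltW ?p_le1.
- apply: prodr_ile1 => s _; apply/andP; split.
    by apply: prodr_ge0 => a _; apply: ltW.
  by apply: prodr_ile1 => a _; rewrite ltW ?p_le1.
Qed.

Lemma least_weight_le1 : least_weight <= 1.
Proof.
apply: prodr_ile1 => r _; apply/andP; split.
  by apply: prodr_ge0 => a _; apply: ltW.
by apply: prodr_ile1 => a _; rewrite ltW ?p_le1.
Qed.

Section Domain.
Variable n : nat.
Notation T := 'I_n.+1.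

(** The independent coordinates of a random structure, one for each ground atom. *)
Definition atom_of : finType := {r : tau & (rel_arity r).-tuple T}.

Definition of_atoms (f : {ffun atom_of -> A}) : structure A tau T :=
  [ffun r : tau => [ffun t : (rel_arity r).-tuple T => f (Tagged _ t)]
    : {ffun (rel_arity r).-tuple T -> A}].

Lemma of_atoms_bij : bijective of_atoms.
Proof.
exists (fun M : structure A tau T => [ffun i => M (tag i) (tagged i)]).
  by move=> f; apply/ffunP => -[r t]; rewrite !ffunE.
by move=> M; apply/ffunP => r; rewrite ffunE; apply/ffunP => t; rewrite !ffunE.
Qed.

Lemma Pr_of_atoms f : Pr p (of_atoms f) = \prod_i p (tag i) (f i).
Proof.
rewrite /Pr sig_big_dep /=; apply: eq_bigr => -[r t] _ /=.
by rewrite !ffunE.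
Qed.

Lemma sum_structures (P : pred (structure A tau T)) :
  \sum_(M | P M) Pr p M = \sum_(f | P (of_atoms f)) \prod_i p (tag i) (f i).
Proof.
rewrite (reindex of_atoms); last by apply: onW_bij; apply: of_atoms_bij.
by apply: eq_bigr => f _; apply: Pr_of_atoms.
Qed.

Lemma Pr_ge0 (M : structure A tau T) : 0 <= Pr p M.
Proof. by apply: prodr_ge0 => r _; apply: prodr_ge0 => t _; apply: ltW. Qed.

Lemma sum_Pr : \sum_(M : structure A tau T) Pr p M = 1.
Proof.
rewrite (sum_structures predT) /= -(bigA_distr_bigA (fun i : atom_of => p (tag i))) big1 // => i _.
by have [] := p_pos (tag i).
Qed.

Section Witness.
Variables (s : K.-tuple T) (h : structure A tau 'I_K.+1).

Definition fresh : finType := {e : T | e \notin s}.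

Definition new_atoms (e : fresh) : {set atom_of} :=
  [set i : atom_of | (val e \in tagged i) && all (mem (val e :: s)) (tagged i)].

Definition target (i : atom_of) : A :=
  h (tag i) (map_tuple (fun y => inord (index y s)) (tagged i)).

Definition unrealized (f : {ffun atom_of -> A}) : bool :=
  [forall e, [exists i in new_atoms e, f i != target i]].

(** The tuple contains [e] and has entries in [e' :: s] only, while [e] is not in [s]. *)
Lemma new_atoms_disjoint e e' i : i \in new_atoms e -> i \in new_atoms e' -> e = e'.
Proof.
rewrite !inE => /andP[ei _] /andP[_ /allP /(_ _ ei)].
by rewrite inE => /orP[/eqP /val_inj //|es]; case/negP: (valP e).
Qed.

Let kappa := #|{: {r : tau & (rel_arity r).-tuple 'I_K.+1}}|.

(** Renaming entries by their index in [s] bounds the number independently of [n]. In [g] the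
    default of [nth] returns [e] for index [K]. *)
Lemma card_new_atoms e : (#|new_atoms e| <= kappa)%N.
Proof.
pose g (u : {r : tau & (rel_arity r).-tuple 'I_K.+1}) : atom_of :=
  Tagged (fun r => (rel_arity r).-tuple T)
    (map_tuple (fun k : 'I_K.+1 => nth (val e) s k) (tagged u)).
apply: leq_trans (leq_imset_card g predT); apply: subset_leq_card.
apply/fintype.subsetP => -[r t]; rewrite inE /= => /andP[_ /allP ht].
apply/imsetP; exists (Tagged (fun r => (rel_arity r).-tuple 'I_K.+1)
  (map_tuple (fun y => inord (index y s) : 'I_K.+1) t)) => //.
congr (Tagged _ _); apply: eq_from_tnth => j; rewrite !tnth_map.
have js : (index (tnth t j) s <= K)%N by rewrite -{2}(size_tuple s) index_size.
rewrite inordK //; have := ht _ (mem_tnth j t).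
rewrite inE => /orP[/eqP ->|js']; last by rewrite nth_index.
by rewrite nth_default // memNindex ?(valP e).
Qed.

Lemma card_fresh : (n.+1 - K <= #|fresh|)%N.
Proof.
rewrite card_sig; have := cardC (mem s); rewrite card_ord => cs.
have := card_size s; rewrite size_tuple => sK.
have -> : #|[pred e : T | e \notin s]| = #|[predC mem s]| by apply: eq_card.
by rewrite leq_subLR -{1}cs leq_add2r.
Qed.

(** The fresh points fail independently, each with probability at most [1 - least_weight ^+ kappa],
    and there are at least [n.+1 - K] of them. *)
Lemma unrealized_le :
  \sum_(f | unrealized f) \prod_i p (tag i) (f i) <=
  (1 - least_weight ^+ kappa) ^+ (n.+1 - K).
Proof.
rewrite (@sum_avoid _ _ _ _ (fun i => p (tag i)) new_atoms target); first last.
- exact: new_atoms_disjoint.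
- by move=> i; have [] := p_pos (tag i).
have w0 := least_weight_gt0; have w1 := least_weight_le1.
have q0 : 0 <= 1 - least_weight ^+ kappa <= 1.
  apply/andP; split; first by rewrite subr_ge0 exprn_ile1 // ltW.
  by rewrite gerBl exprn_ge0 // ltW.
apply: (@le_trans _ _ ((1 - least_weight ^+ kappa) ^+ #|fresh|)); last first.
  by case/andP: q0 => q0 q1; apply: ler_wiXn2l => //; apply: card_fresh.
rewrite -prodr_const; apply: ler_prod => e _; rewrite subr_ge0 prodr_ile1 /=; last first.
  by move=> i _; rewrite ltW ?p_le1.
rewrite lerB //; apply: (@le_trans _ _ (least_weight ^+ #|new_atoms e|)).
  by apply: ler_wiXn2l => //; [exact: ltW|exact: card_new_atoms].
rewrite -prodr_const; apply: ler_prod => i _.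
by rewrite ltW //= least_weight_le.
Qed.

End Witness.

(** Union bound over the pairs [(s, h)]; the number of patterns [h] does not depend on [n]. *)
Lemma not_extension_le :
  \sum_(M : structure A tau T | ~~ extension K M) Pr p M <=
  #|structure A tau 'I_K.+1|%:R * n.+1%:R ^+ K *
  (1 - least_weight ^+ #|{: {r : tau & (rel_arity r).-tuple 'I_K.+1}}|) ^+ (n.+1 - K).
Proof.
rewrite (sum_structures (fun M => ~~ extension K M)).
apply: (@le_trans _ _ (\sum_(sh : K.-tuple T * structure A tau 'I_K.+1)
   \sum_(f | unrealized sh.1 sh.2 f) \prod_i p (tag i) (f i))); last first.
  apply: (@le_trans _ _ (\sum_(sh : K.-tuple T * structure A tau 'I_K.+1)
    (1 - least_weight ^+ #|{: {r : tau & (rel_arity r).-tuple 'I_K.+1}}|) ^+ (n.+1 - K))).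
    by apply: ler_sum => sh _; apply: unrealized_le.
  by rewrite sumr_const card_prod card_tuple card_ord -[X in X <= _]mulr_natl natrM natrX
     [X in X * _]mulrC.
under [X in _ <= X]eq_bigr do rewrite big_mkcond.
rewrite exchange_big /= big_mkcond /=; apply: ler_sum => f _.
have W0 : 0 <= \prod_i p (tag i) (f i) by apply: prodr_ge0 => i _; apply: ltW.
case: ifP => [|_]; last by apply: sumr_ge0 => sh _; case: ifP.
rewrite /extension negb_forall => /existsP[s]; rewrite negb_forall => /existsP[h].
rewrite negb_exists => /forallP bad.
have un : unrealized s h f.
  apply/forallP => e; have := bad (val e); rewrite (valP e) /= negb_forall => /existsP[r].
  rewrite negb_forall => /existsP[t]; rewrite !negb_imply => /and3P[et ht ne].
  apply/exists_inP; exists (Tagged (fun r => (rel_arity r).-tuple T) t); first by rewrite inE et ht.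
  by move: ne; rewrite !ffunE.
rewrite (bigD1 (s, h)) //= un lerDl; apply: sumr_ge0 => sh _; by case: ifP.
Qed.

End Domain.

End AlmostSure.

(** * From extension properties to almost sure values *)

Section ZeroOne.
Local Open Scope ring_scope.
Local Open Scope classical_set_scope.
Variables (R : realType) (disp : Order.disp_t) (A : latticeAlgebra disp) (tau : vocabulary).
Variables (phi : formula A tau) (a : A) (K : nat).
Hypothesis phi_a : forall n (M : structure A tau 'I_n.+1),
  extension K M -> value M (fun=> ord0) phi = a.

(** Values other than [a] occur only where the extension property fails, so their probability is at
    most [u n] and tends to 0, which excludes the limit 1. *)
Lemma extension_almost_sure : almost_sure_value R phi a.
Proof.
move=> p p_pos b.
pose u n : R := #|structure A tau 'I_K.+1|%:R * n.+1%:R ^+ K *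
  (1 - least_weight p ^+ #|{: {r : tau & (rel_arity r).-tuple 'I_K.+1}}|) ^+ (n.+1 - K).
have u0 : u n @[n --> \oo] --> (0 : R).
  apply: poly_geometric_cvg0 => //.
  have w0 := least_weight_gt0 p_pos; have w1 := least_weight_le1 p_pos.
  apply/andP; split; first by rewrite subr_ge0 exprn_ile1 // ltW.
  by rewrite gtrBl exprn_gt0.
have split_mu c n : mu p phi c n <= 1.
  rewrite /mu -(sum_Pr p_pos n) [X in _ <= X](bigID (fun M => value M (fun=> ord0) phi == c)) /=.
  by rewrite lerDl; apply: sumr_ge0 => M _; apply: Pr_ge0.
have mu_ne c n : c != a -> 0 <= mu p phi c n <= u n.
  move=> ca; apply/andP; split; first by apply: sumr_ge0 => M _; apply: Pr_ge0.
  apply: le_trans (not_extension_le K p_pos n).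
  rewrite /mu [X in X <= _]big_mkcond [X in _ <= X]big_mkcond; apply: ler_sum => M _.
  case: eqP => [e|_]; last by case: ifP => // _; apply: Pr_ge0.
  by case: (boolP (extension K M)) => //= /phi_a e'; rewrite -e -e' eqxx in ca.
have mu_a n : 1 - u n <= mu p phi a n.
  rewrite lerBlDr -(sum_Pr p_pos n) (bigID (fun M => value M (fun=> ord0) phi == a)) /=.
  rewrite lerD2l; apply: le_trans (not_extension_le K p_pos n).
  rewrite [X in X <= _]big_mkcond [X in _ <= X]big_mkcond; apply: ler_sum => M _.
  case: (boolP (extension K M)) => [/phi_a ->|_ /=]; first by rewrite eqxx.
  by case: ifP => // _; apply: Pr_ge0.
split=> [h|->].
  apply/eqP; apply: contraT => ba; have h0 : mu p phi b n @[n --> \oo] --> (0 : R).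
    by apply: (@squeeze_cvgr _ _ _ _ (cst 0) u) => //; [apply: nearW => n; apply: mu_ne|apply: cvg_cst].
  have e1 := cvg_lim (@Rhausdorff R) h; have e0 := cvg_lim (@Rhausdorff R) h0.
  have e10 : (1 : R) = 0 := etrans (esym (e1 _)) (e0 _).
  by have := oner_neq0 R; rewrite e10 eqxx.
apply: (@squeeze_cvgr _ _ _ _ (fun n => 1 - u n) (cst 1)).
- by apply: nearW => n; rewrite mu_a split_mu.
- by rewrite -[X in _ --> X]subr0; apply: cvgB => //; apply: cvg_cst.
- exact: cvg_cst.
Qed.

End ZeroOne.

(** There are 21 tapes of at most [B.+1] cells each, where [B] bounds every index into [n] blocks of
    length [n ^ m], with slack for intermediate values. *)
Lemma evaluator_computes (disp : Order.disp_t) (A : latticeAlgebra disp) (tau : vocabulary)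
    m (phi : formula A tau) a :
  let n := size (encode phi) in
  (forall r : tau, n ^ rel_arity r <= n ^ m) -> n <= n ^ m ->
  a = sure_value (@digit _ A tau) n (n ^ m) phi 0 [::] (fun=> None) ->
  computes_in_space (compile (evaluator A tau m)) (encode phi) a
    (21 * ((n + 2) * (n ^ m + 2) + 1)).
Proof.
move=> n har nm ->; have n0 : 0 < n by rewrite /n; case: (phi).
have [e [S' [r eS]]] := evaluator_run n0 (leqnn ((n + 2) * (n ^ m + 2))) erefl har nm.
rewrite -eS [X in 21 * X]addn1; apply: (compile_computes _ _ _ _ r) => //.
- by rewrite -/n; nia.
- by case=> [|[|[|i]]] //= ->.
Qed.

Theorem theorem3p9 (R : realType) (d : Order.disp_t) (A : latticeAlgebra d)
    (tau : vocabulary) :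
  exists (M : machine (letter A tau) A) (q : {poly nat}),
    forall phi : formula A tau, sentence phi ->
      exists a : A,
        almost_sure_value R phi a /\
        computes_in_space M (encode phi) a (q.[size (encode phi)])%R.
Proof.
(* The successor gives [n <= n ^ m] even if [tau] is empty. *)
pose m := (\max_(r : tau) rel_arity r).+1.
exists (compile (evaluator A tau m)),
  (21%:P * (('X + 2%:P) * ('X^m + 2%:P) + 1%:P))%R => phi hphi.
set n := size (encode phi); have n0 : 0 < n by rewrite /n; case: (phi).
have nm : n <= n ^ m by rewrite -{1}(expn1 n) leq_pexp2l.
have har (r : tau) : n ^ rel_arity r <= n ^ m.
  by rewrite leq_pexp2l // ltnW // ltnS leq_bigmax.
exists (sure_value (@digit _ A tau) n (n ^ m) phi 0 [::] (fun=> None)); split; last first.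
  rewrite !(poly.hornerM, poly.hornerD, poly.hornerC, poly.hornerX, poly.hornerXn).
  rewrite natrXE.
  exact: evaluator_computes.
apply: (@extension_almost_sure _ _ _ _ _ _ n) => k M hM.
exact: (sentence_value nm har (@encode_digitK _ A tau) ord0 hM).
Qed.
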